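(* Let $n\ge1$, let $f:\Omega_n=\{-1,1\}^n\to\mathbb{C}$ be a function and let $t>0$. Then $$\mathbb{P}\{|f-\mathbb{E}f|>t\}\le2\exp\Big(-\frac{8t^2}{\pi^2\Vert\,|\nabla f|\,\Vert_\infty^2}\Big).$$ Let $0<\alpha<\frac12$ and $K_\alpha=\frac1{\Gamma(1-\alpha)}\int_0^{\pi/2}(-\log\cos\theta)^{-\alpha}d\theta$. Then $$\mathbb{P}\{|\Delta^\alpha f|>t\}\le2\exp\Big(-\frac{t^2}{2K_\alpha^2\Vert\,|\nabla f|\,\Vert_\infty^2}\Big).$$
   Context: $\Omega_n=\{-1,1\}^n$ carries the uniform probability $\mathbb{P}$, with expectation $\mathbb{E}$. For $x,y\in\Omega_n$, $xy$ is the coordinatewise product; $e_j\in\Omega_n$ has $-1$ in coordinate $j$ and $1$ elsewhere; $(\partial_jf)(x)=f(x)-f(xe_j)$; $|\nabla f|=(\sum_{j=1}^n|\partial_jf|^2)^{1/2}$ pointwise. With $\omega_j$ the coordinate functions and $\omega_A=\prod_{j\in A}\omega_j$ ($\omega_\emptyset=1$), the discrete Laplacian $\Delta=\sum_j\partial_j^*\partial_j$ (adjoint in $L^2(\Omega_n)$) satisfies $\Delta\omega_A=4|A|\omega_A$, and $\Delta^\alpha\omega_A=(4|A|)^\alpha\omega_A$ for $A\ne\emptyset$, $\Delta^\alpha1=0$, extended linearly. When $\nabla f=0$ the right-hand sides are read as $0$. *)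

(* Defs.v *)
From HB Require Import structures.
From mathcomp Require Import all_boot all_order all_algebra.
From mathcomp Require Import complex.
From mathcomp Require Import all_classical all_reals all_analysis.

Set Implicit Arguments.
Unset Strict Implicit.
Unset Printing Implicit Defensive.

Import Order.TTheory GRing.Theory Num.Theory.
Import numFieldNormedType.Exports.

Local Open Scope ring_scope.
Local Open Scope complex_scope.

(* Sign vectors are encoded by bits: [x j = true] means that the j-th
   coordinate is -1, so that the product of signs is exclusive or. *)
Definition cube (n : nat) : finType := {ffun 'I_n -> bool}.

Definition cmul n (x y : cube n) : cube n := [ffun j => x j (+) y j].

Definition cflip n (j : 'I_n) : cube n := [ffun i => i == j].

Definition Pr (R : realType) n (A : {set cube n}) : R := #|A|%:R / 2 ^+ n.

Definition Ex (R : realType) n (f : cube n -> R[i]) : R[i] :=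
  (\sum_x f x) / 2 ^+ n.

Definition cabs (R : realType) (z : R[i]) : R := ComplexField.Normc.normc z.

Definition partial (R : realType) n (j : 'I_n) (f : cube n -> R[i]) :
  cube n -> R[i] := fun x => f x - f (cmul x (cflip j)).

Definition gradnorm (R : realType) n (f : cube n -> R[i]) : cube n -> R :=
  fun x => Num.sqrt (\sum_(j < n) cabs (partial j f x) ^+ 2).

(* Every point of the cube has positive probability, so the essential supremum
   is a maximum; 0 is neutral because absolute values are nonnegative. *)
Definition supnorm (R : realType) n (g : cube n -> R) : R :=
  \big[Num.max/0]_x `|g x|.

Definition walsh (R : realType) n (A : {set 'I_n}) : cube n -> R[i] :=
  fun x => \prod_(j in A) (-1) ^+ x j.

Definition dotp (R : realType) n (f g : cube n -> R[i]) : R[i] :=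
  Ex (fun x => f x * conjc (g x)).

(* [partial j] is its own adjoint, see [partial_adjoint]. *)
Definition laplacian (R : realType) n (f : cube n -> R[i]) : cube n -> R[i] :=
  fun x => \sum_(j < n) partial j (partial j f) x.

(* The linear extension is written out on the Walsh expansion of f, whose
   coefficient at A is [dotp f (walsh R A)], see [walsh_expansion]. *)
Definition laplacian_pow (R : realType) n (alpha : R) (f : cube n -> R[i]) :
  cube n -> R[i] :=
  fun x => \sum_(A : {set 'I_n} | A != finset.set0)
    dotp f (walsh R A) * (((4 * #|A|)%:R `^ alpha)%:C * walsh R A x).

Definition Gamma (R : realType) (s : R) : R :=
  (\int[lebesgue_measure]_(u in `]0%R, +oo[) (u `^ (s - 1) * expR (- u)))%R.

(* The integrand takes the value 0 instead of +oo at theta = 0, and 0 at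
   theta = pi / 2 because [ln 0 = 0]; these points have measure zero. *)
Definition Kconst (R : realType) (alpha : R) : R :=
  (Gamma (1 - alpha))^-1 *
  (\int[lebesgue_measure]_(theta in `[0%R, (pi / 2)%R])
     (- ln (cos theta)) `^ (- alpha))%R.

Section Facts.
Variables (R : realType) (n : nat).
Implicit Types (f g : cube n -> R[i]) (A B : {set 'I_n}) (x y : cube n).

Lemma cmulK y : involutive (fun x : cube n => cmul x y).
Proof. by move=> x; apply/ffunP => j; rewrite !ffunE addbK. Qed.

Lemma sum_cmul y f : \sum_x f (cmul x y) = \sum_x f x.
Proof. by rewrite [RHS](reindex_inj (inv_inj (cmulK y))). Qed.

Lemma partial_adjoint (j : 'I_n) f g :
  dotp (partial j f) g = dotp f (partial j g).
Proof.
rewrite /dotp /Ex; congr (_ / _); rewrite /partial.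
under eq_bigr do rewrite mulrBl.
under [RHS]eq_bigr do rewrite rmorphB mulrBr.
rewrite !sumrB; congr (_ - _).
rewrite -[LHS](sum_cmul (cflip j)); apply: eq_bigr => x _.
by rewrite cmulK.
Qed.

Lemma walsh_cmul A x y : walsh R A (cmul x y) = walsh R A x * walsh R A y.
Proof.
rewrite /walsh -big_split /=; apply: eq_bigr => j _.
by rewrite ffunE signr_addb.
Qed.

Lemma walsh_cflip A (j : 'I_n) :
  walsh R A (cflip j) = if j \in A then -1 else 1.
Proof.
rewrite /walsh; case: ifPn => jA.
  rewrite (bigD1 j) //= big1 ?ffunE ?eqxx ?mulr1 ?expr1 //.
  by move=> i /andP[_ /negbTE ij]; rewrite ffunE ij.
apply: big1 => i iA; rewrite ffunE; case: eqP => // ij.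
by rewrite -ij iA in jA.
Qed.

Lemma laplacian_walsh A x :
  laplacian (walsh R A) x = (4 * #|A|)%:R * walsh R A x.
Proof.
have E (j : 'I_n) : partial j (partial j (walsh R A)) x =
    if j \in A then 4%:R * walsh R A x else 0.
  rewrite /partial cmulK walsh_cmul walsh_cflip; case: ifP => _.
    by rewrite mulrN1 !opprK opprD opprK -!mulr2n -mulrnA mulr_natl.
  by rewrite mulr1 !subrr.
rewrite /laplacian (eq_bigr _ (fun j _ => E j)) -big_mkcond sumr_const.
by rewrite natrM -mulrnAl mulr_natr.
Qed.

Lemma walsh_conj A x : conjc (walsh R A x) = walsh R A x.
Proof.
rewrite rmorph_prod; apply: eq_bigr => j _.
by rewrite rmorphXn rmorphN rmorph1.
Qed.

Lemma walsh_expansion f x :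
  f x = \sum_(A : {set 'I_n}) dotp f (walsh R A) * walsh R A x.
Proof.
have E y : \sum_(A : {set 'I_n}) walsh R A (cmul y x) =
    if y == x then 2 ^+ n else 0.
  transitivity (\prod_(j < n) ((-1) ^+ (cmul y x j) + 1 : R[i])).
    rewrite bigA_distr; apply: eq_bigr => A _.
    by rewrite /walsh big_mkcond.
  case: eqP => [->|/eqP yx].
    rewrite (eq_bigr (fun=> 2)) ?prodr_const ?card_ord // => j _.
    by rewrite ffunE addbb expr0.
  have [j ij] : exists j, y j != x j.
    apply/existsP; rewrite -negb_forall; apply: contra yx => /forallP h.
    by apply/eqP/ffunP => j; apply/eqP/h.
  rewrite (bigD1 j) //= ffunE.
  have -> : y j (+) x j = true by move: ij; case: (y j); case: (x j).
  by rewrite expr1 addNr mul0r.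
rewrite /dotp /Ex.
under eq_bigr do rewrite mulrAC mulr_suml.
rewrite -mulr_suml exchange_big /=.
rewrite (eq_bigr (fun y => f y * (if y == x then 2 ^+ n else 0))); last first.
  move=> y _; rewrite -E mulr_sumr; apply: eq_bigr => A _.
  by rewrite walsh_conj -mulrA -walsh_cmul.
rewrite (bigD1 x) //= eqxx big1 ?addr0; last first.
  by move=> y /negbTE ->; rewrite mulr0.
by rewrite mulfK // expf_neq0 // pnatr_eq0.
Qed.

Lemma laplacian_powD alpha f g x :
  laplacian_pow alpha (fun x => f x + g x) x =
  laplacian_pow alpha f x + laplacian_pow alpha g x.
Proof.
rewrite /laplacian_pow -big_split /=; apply: eq_bigr => A _.
rewrite -mulrDl; congr (_ * _).
rewrite /dotp /Ex -mulrDl -big_split /=; congr (_ / _).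
by apply: eq_bigr => y _; rewrite mulrDl.
Qed.

Lemma laplacian_powZ alpha (c : R[i]) f x :
  laplacian_pow alpha (fun x => c * f x) x = c * laplacian_pow alpha f x.
Proof.
rewrite /laplacian_pow mulr_sumr; apply: eq_bigr => A _.
rewrite [RHS]mulrA; congr (_ * _).
rewrite /dotp /Ex mulrA mulr_sumr; congr (_ / _).
by apply: eq_bigr => y _; rewrite mulrA.
Qed.

Lemma dotp_walsh A B : dotp (walsh R A) (walsh R B) = (A == B)%:R.
Proof.
have n2 : 2 ^+ n != 0 :> R[i] by rewrite expf_neq0 // pnatr_eq0.
rewrite /dotp /Ex; under eq_bigr do rewrite walsh_conj.
have [->|AB] := eqVneq A B.
  rewrite (eq_bigr (fun=> 1)); last first.
    move=> x _; rewrite -walsh_cmul /walsh big1 // => j _.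
    by rewrite ffunE addbb expr0.
  by rewrite sumr_const card_ffun card_bool card_ord natrX divff.
have [j jAB] : exists j, (j \in A) != (j \in B).
  apply/existsP; rewrite -negb_forall; apply: contra AB => /forallP h.
  by apply/eqP/setP => j; apply/eqP/h.
set S := \sum_x _; suff -> : S = 0 by rewrite mul0r.
have : S = - S.
  rewrite {1}/S -(sum_cmul (cflip j)) -sumrN; apply: eq_bigr => x _.
  rewrite !walsh_cmul !walsh_cflip; move: jAB.
  by case: (j \in A); case: (j \in B) => // _;
    rewrite ?mulrN1 ?mulr1 ?mulrN ?mulNr.
by move/eqP; rewrite -subr_eq0 opprK -mulr2n mulrn_eq0 /= => /eqP.
Qed.

Lemma laplacian_pow_walsh alpha A x : A != finset.set0 ->
  laplacian_pow alpha (walsh R A) x = ((4 * #|A|)%:R `^ alpha)%:C * walsh R A x.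
Proof.
move=> A0; rewrite /laplacian_pow (bigD1 A) //= dotp_walsh eqxx mul1r.
rewrite big1 ?addr0 // => B /andP[_ BA].
by rewrite dotp_walsh eq_sym (negbTE BA) mul0r.
Qed.

Lemma laplacian_pow1 alpha x : laplacian_pow alpha (fun=> 1 : R[i]) x = 0.
Proof.
rewrite /laplacian_pow big1 // => B B0.
have -> : dotp (fun=> 1) (walsh R B) = dotp (walsh R finset.set0) (walsh R B).
  rewrite /dotp /Ex; congr (_ / _); apply: eq_bigr => y _.
  by rewrite [walsh R finset.set0 y]big_set0.
by rewrite dotp_walsh eq_sym (negbTE B0) mul0r.
Qed.

End Facts.

(* Main.v *)
Require Import Defs.
From HB Require Import structures.
From mathcomp Require Import all_boot all_order all_algebra.
From mathcomp Require Import complex.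
From mathcomp Require Import all_classical all_reals all_analysis.
From mathcomp Require Import measurable_realfun.
From mathcomp Require Import ring lra.

Set Implicit Arguments.
Unset Strict Implicit.
Unset Printing Implicit Defensive.

Import Order.TTheory GRing.Theory Num.Theory.
Import numFieldNormedType.Exports.

Local Open Scope ring_scope.
Local Open Scope complex_scope.

(** Write G for the supremum of |grad f| and F = Delta^alpha f.  For alpha = 0
    one has F = f - E f and K_0 = pi / 2, so both inequalities are instances of
    the single bound [tail_laplacian_pow],
      P(|F| > t) <= 2 exp(- t^2 / (2 sigma^2)),  sigma = 4^alpha K_alpha G / 2,
    and 4^alpha <= 2 when alpha < 1/2.  By Markov's inequality it follows from
      E cosh(lambda |F|) <= exp(lambda^2 sigma^2 / 2)
    at lambda = t / sigma^2 ([mean_cosh_laplacian_pow_le]).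

    This exponential moment is bounded by duality with an entropy.  A pair
    (w, v) of a complex number and a real number with |w| < v stands for the
    positive 2x2 matrix with diagonal v / 2 and off-diagonal entries w / 2 and
    its conjugate; its eigenvalues are (v + |w|) / 2 and (v - |w|) / 2, and
    [psi] is its trace of x ln x.  Using matrices instead of positive densities
    is what makes the argument work for complex f at the cost of a factor 2
    only: with Z = E v, the entropy of a pair of functions (w, v) is at least
    Z ln (Z / 2).  The pair
      w = sinh(lambda |F|) F / |F|,  v = cosh(lambda |F|)
    is the Gibbs state, whose entropy is lambda E(Re (conj w * F)) - Z ln 2.

    It remains to bound E(Re (conj w * F)) by the entropy.  Let T_rho be the
    noise operator, which multiplies the Walsh function of A by rho^|A|, let
    D_j be half of the j-th partial difference, and M_j the average over the
    j-th coordinate.  Applying the noise one coordinate at a time, strong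
    convexity of the entropy on two points ([psi_two_point]) and joint
    convexity of |x|^2 / y give ([fisher_noise_seq])
      sum_j E |D_j T_rho w|^2 / M_j T_rho v
        <= 2 rho^2 / (1 - rho^2) * (entropy (w, v) - entropy (T_rho w, T_rho v)).
    Since |D_j f|^2 does not change when coordinate j is flipped, it can be
    averaged against M_j T_rho v as well as against T_rho v, and Young's
    inequality yields a bound of
      sum_j E(Re (D_j f * conj (D_j T_rho w)))
        = sum_A |A| rho^|A| Re (hat f(A) * conj (hat w(A)))
    by rho / sqrt(1 - rho^2) times an entropy term
    ([energy_noise_le_entropy], [energy_walsh]).  At rho = cos theta this
    factor is cot theta, and the substitution u = - k ln cos theta in the Gamma
    integral,
      Gamma(1 - alpha) k^alpha
        = int_0^(pi/2) (- ln cos theta)^(-alpha) k cos^k theta tan theta dtheta,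
    integrates the bound to one of E(Re (conj w * F)) in which exactly the
    constant K_alpha appears ([power_sum_le_Kconst]). *)

(** * Strong convexity of the two-level entropy *)

Section Entropy.
Variable R : realType.
Implicit Types (a b c d r s t u v x y rho : R).

Lemma ln_ge_frac x : 1 <= x -> 2 * (x - 1) / (x + 1) <= ln x.
Proof.
move=> x1; pose g (y : R) : R := ln y - 2 * (y - 1) / (y + 1).
have dg (y : R) : 0 < y -> is_derive y 1 g ((y - 1) ^+ 2 / (y * (y + 1) ^+ 2)).
  move=> y0; have yy : y + 1 != 0 by lra.
  have yn : y != 0 by lra.
  have H : is_derive y 1 (@ln R) y^-1 by exact: is_derive1_ln.
  have H2 : is_derive y 1 (fun y : R => (y + 1)^-1) (- (y + 1) ^- 2 *: (1 + 0)).
    by apply: is_deriveV.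
  rewrite /g; apply: is_derive_eq.
  rewrite /GRing.scale /=; field.
  by rewrite yy.
have : g 1 <= g x.
  case: (ltgtP 1 x) => [lx|lx|<-//]; last lra.
  apply: (@ger0_derive1_le_cc _ g 1 x) => //.
  - by move=> y; rewrite in_itv/= => /andP[y1 _]; have [] := dg y (lt_trans ltr01 y1).
  - move=> y; rewrite in_itv/= => /andP[y1 _]; rewrite derive1E.
    have := dg y (lt_trans ltr01 y1) => H; rewrite derive_val.
    by rewrite divr_ge0 ?sqr_ge0// mulr_ge0 ?sqr_ge0//; lra.
  - apply: derivable_within_continuous => y; rewrite in_itv/= => /andP[y1 _].
    by have [] := dg y (lt_le_trans ltr01 y1).
  - by rewrite in_itv/= lexx.
  - by rewrite in_itv/= lexx ltW.
by rewrite /g ln1 !subrr mulr0 mul0r subr0 subr_ge0.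
Qed.

(** This is the comparison of the logarithmic mean of a and b with their
    arithmetic mean, cleared of denominators. *)
Lemma ln_strong_mono a b : 0 < a -> 0 < b ->
  2 * ((a - b) ^+ 2 / (a + b)) <= (a - b) * (ln a - ln b).
Proof.
wlog ab : a b / b <= a.
  move=> H a0 b0; case: (leP b a) => [ba|/ltW ba]; first exact: H.
  have := H b a ba b0 a0; rewrite -(opprB a b) -(opprB (ln a)) sqrrN mulrNN.
  by rewrite addrC [b + a]addrC addrC.
move=> a0 b0; have b1 : b != 0 by lra.
have ab0 : a + b != 0 by lra.
have := @ln_ge_frac (a / b).
rewrite ler_pdivlMr// mul1r => /(_ ab).
rewrite ln_div ?posrE// => H.
have -> : 2 * ((a - b) ^+ 2 / (a + b)) = (a - b) * (2 * (a / b - 1) / (a / b + 1)).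
  by field; rewrite ab0 b1.
by apply: ler_wpM2l => //; lra.
Qed.

Definition xlnx x := x * ln x.

Lemma xlnx_tangent a b : 0 < a -> 0 < b ->
  xlnx b + (ln b + 1) * (a - b) <= xlnx a.
Proof.
move=> a0 b0; rewrite /xlnx.
have b1 : b != 0 by lra.
have a1 : a != 0 by lra.
have := @le_ln1Dx _ (b / a - 1).
have -> : 1 + (b / a - 1) = b / a by ring.
rewrite ln_div ?posrE//.
have : 0 < b / a by rewrite divr_gt0.
move=> h /(_ ltac:(lra)) => H.
have : a * (ln b - ln a) <= a * (b / a - 1) by apply: ler_wpM2l => //; lra.
have -> : a * (b / a - 1) = b - a by field.
lra.
Qed.

(** [slope] and [level] are the partial derivatives of [psi] below in r and v. *)
Definition slope r v := (ln ((v + r) / 2) - ln ((v - r) / 2)) / 2.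
Definition level r v := (ln ((v + r) / 2) + ln ((v - r) / 2)) / 2 + 1.
(** Trace of x ln x for a 2x2 Hermitian matrix of trace v whose eigenvalues
    differ by r. *)
Definition psi r v := xlnx ((v + r) / 2) + xlnx ((v - r) / 2).

Lemma slopeN r v : slope (- r) v = - slope r v.
Proof. by rewrite /slope opprK -mulNr opprB. Qed.

Lemma levelN r v : level (- r) v = level r v.
Proof. by rewrite /level opprK [ln _ + ln _]addrC. Qed.

Lemma slope0 v : slope 0 v = 0.
Proof. by rewrite /slope subr0 addr0 subrr mul0r. Qed.

Lemma slope_ge0 r v : 0 <= r -> r < v -> 0 <= slope r v.
Proof.
by move=> r0 rv; rewrite divr_ge0// subr_ge0 ler_ln ?posrE; lra.
Qed.

Lemma psi_tangent r v s u : `|r| < v -> `|s| < u ->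
  psi s u + slope s u * (r - s) + level s u * (v - u) <= psi r v.
Proof.
rewrite !ltr_norml => /andP[r1 r2] /andP[s1 s2]; rewrite /psi /slope /level.
have := @xlnx_tangent ((v + r) / 2) ((u + s) / 2) ltac:(lra) ltac:(lra).
have := @xlnx_tangent ((v - r) / 2) ((u - s) / 2) ltac:(lra) ltac:(lra).
lra.
Qed.

Lemma sqr_div_add a b x y : 0 < x -> 0 < y ->
  (a - b) ^+ 2 / (x + y) <= a ^+ 2 / x + b ^+ 2 / y.
Proof.
move=> x0 y0; have xy : 0 < x + y by lra.
rewrite -subr_ge0.
have -> : a ^+ 2 / x + b ^+ 2 / y - (a - b) ^+ 2 / (x + y) =
    (a * y + b * x) ^+ 2 / (x * y * (x + y)).
  by field; lra.
by rewrite divr_ge0 ?sqr_ge0// !mulr_ge0// ltW.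
Qed.

(** The two eigenvalues contribute one instance of [ln_strong_mono] each, and
    the Cauchy-Schwarz inequality [sqr_div_add] merges the two quotients so that
    only the variation of r remains. *)
Lemma psi_strong_mono r v s u : `|r| < v -> `|s| < u ->
  2 * ((r - s) ^+ 2 / (v + u)) <=
  (slope r v - slope s u) * (r - s) + (level r v - level s u) * (v - u).
Proof.
rewrite !ltr_norml => /andP[r1 r2] /andP[s1 s2]; rewrite /slope /level.
have := @ln_strong_mono ((v + r) / 2) ((u + s) / 2) ltac:(lra) ltac:(lra).
have := @ln_strong_mono ((v - r) / 2) ((u - s) / 2) ltac:(lra) ltac:(lra).
have := @sqr_div_add (((v + r) / 2 - (u + s) / 2)) ((v - r) / 2 - (u - s) / 2)
  ((v + r) / 2 + (u + s) / 2) ((v - r) / 2 + (u - s) / 2) ltac:(lra) ltac:(lra).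
set A := ((v + r) / 2 - (u + s) / 2) ^+ 2 / _.
set B := ((v - r) / 2 - (u - s) / 2) ^+ 2 / _.
have -> : (v + r) / 2 + (u + s) / 2 + ((v - r) / 2 + (u - s) / 2) = v + u by field.
have -> : (v + r) / 2 - (u + s) / 2 - ((v - r) / 2 - (u - s) / 2) = r - s by field.
rewrite -/A -/B.
lra.
Qed.

Definition nrm2 a b := Num.sqrt (a ^+ 2 + b ^+ 2).

Lemma nrm2_ge0 a b : 0 <= nrm2 a b. Proof. exact: sqrtr_ge0. Qed.

Lemma nrm2_sqr a b : nrm2 a b ^+ 2 = a ^+ 2 + b ^+ 2.
Proof. by rewrite sqr_sqrtr// addr_ge0 ?sqr_ge0. Qed.

Lemma nrm2_cs a b c d : `|a * c + b * d| <= nrm2 a b * nrm2 c d.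
Proof.
rewrite -(@ler_pXn2r _ 2)// ?nnegrE ?mulr_ge0 ?nrm2_ge0//.
rewrite exprMn !nrm2_sqr -normrX ger0_norm ?sqr_ge0//.
by have := sqr_ge0 (a * d - b * c); nra.
Qed.

Lemma nrm2_triangle a b c d : nrm2 (a + c) (b + d) <= nrm2 a b + nrm2 c d.
Proof.
rewrite -(@ler_pXn2r _ 2)// ?nnegrE ?addr_ge0 ?nrm2_ge0//.
rewrite sqrrD !nrm2_sqr.
have := nrm2_cs a b c d; rewrite ler_norml => /andP[_]; nra.
Qed.

Lemma nrm2Z x a b : nrm2 (x * a) (x * b) = `|x| * nrm2 a b.
Proof. by rewrite /nrm2 !exprMn -mulrDr sqrtrM ?sqr_ge0// sqrtr_sqr. Qed.

(** The gradient of (a, b) |-> psi (nrm2 a b) v is gslope a b v times (a, b),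
    also at the origin, where the slope vanishes and division by 0 is harmless. *)
Definition gslope a b v := slope (nrm2 a b) v / nrm2 a b.

Lemma gslopeM a b v x : gslope a b v * (nrm2 a b * x) = slope (nrm2 a b) v * x.
Proof.
rewrite /gslope; have [->|r0] := eqVneq (nrm2 a b) 0.
  by rewrite slope0 !mul0r.
by field.
Qed.

Lemma gslope_ge0 a b v : nrm2 a b < v -> 0 <= gslope a b v.
Proof. by move=> h; rewrite divr_ge0 ?nrm2_ge0// slope_ge0 ?nrm2_ge0. Qed.

Lemma psi_nrm2_tangent a b v c d u : nrm2 a b < v -> nrm2 c d < u ->
  psi (nrm2 c d) u + gslope c d u * (c * (a - c) + d * (b - d))
    + level (nrm2 c d) u * (v - u) <= psi (nrm2 a b) v.
Proof.
move=> h k.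
have := @psi_tangent (nrm2 a b) v (nrm2 c d) u.
rewrite !ger0_norm ?nrm2_ge0// => /(_ h k); apply: le_trans.
rewrite lerD2r lerD2l -gslopeM; apply: ler_wpM2l; first exact: gslope_ge0.
rewrite [nrm2 c d * (_ - _)]mulrBr -[nrm2 c d * nrm2 c d]expr2 nrm2_sqr.
have := nrm2_cs c d a b; rewrite ler_norml => /andP[_]; lra.
Qed.

Lemma affine_ge0_ends k l x y : 0 <= k - l * y -> 0 <= k + l * y -> `|x| <= y ->
  0 <= k - l * x.
Proof.
rewrite ler_norml => h1 h2 /andP[h3 h4].
have := normr_ge0 l; case: (leP 0 l) => [l0|l0] _; nra.
Qed.

(** For fixed lengths of (a, b) and (c, d), the difference of the two sides is
    an affine function of the inner product a c + b d.  It is therefore enough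
    to check the two collinear positions, where the claim is
    [psi_strong_mono]. *)
Lemma psi_nrm2_strong_mono a b v c d u : nrm2 a b < v -> nrm2 c d < u ->
  2 * nrm2 (a - c) (b - d) ^+ 2 / (v + u) <=
  (gslope a b v * a - gslope c d u * c) * (a - c) +
  (gslope a b v * b - gslope c d u * d) * (b - d) +
  (level (nrm2 a b) v - level (nrm2 c d) u) * (v - u).
Proof.
move=> h k; rewrite nrm2_sqr.
have := nrm2_ge0 a b; have := nrm2_ge0 c d => s0 r0.
have := @psi_strong_mono (nrm2 a b) v (nrm2 c d) u.
rewrite !ger0_norm ?nrm2_ge0// => /(_ h k).
have := @psi_strong_mono (nrm2 a b) v (- nrm2 c d) u.
rewrite normrN !ger0_norm ?nrm2_ge0// => /(_ h k).
rewrite slopeN levelN => H2 H1.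
have ea := nrm2_sqr a b; have ec := nrm2_sqr c d.
have da := gslopeM a b v (nrm2 a b); have dc := gslopeM c d u (nrm2 c d).
have da' := gslopeM a b v (nrm2 c d); have dc' := gslopeM c d u (nrm2 a b).
set r := nrm2 a b in h r0 ea da da' dc' H1 H2 *.
set s := nrm2 c d in k s0 ec dc da' dc' H1 H2 *.
set A := gslope a b v in da da' *. set C := gslope c d u in dc dc' *.
set Lr := level r v in H1 H2 *. set Ls := level s u in H1 H2 *.
have vu : 0 < v + u by lra.
pose K := A * r ^+ 2 + C * s ^+ 2 + (Lr - Ls) * (v - u) -
  2 * (r ^+ 2 + s ^+ 2) / (v + u).
pose L := A + C - 4 / (v + u).
have : 0 <= K - L * (a * c + b * d).
  apply: (@affine_ge0_ends K L _ (r * s)); last exact: nrm2_cs.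
  - rewrite -subr_ge0 in H1.
    have e : K - L * (r * s) = A * (r * r) + C * (s * s) - A * (r * s) - C * (s * r)
       + (Lr - Ls) * (v - u) - 2 * ((r - s) ^+ 2 / (v + u)).
      by rewrite /K /L; field; lra.
    rewrite e da dc da' dc'; lra.
  - rewrite -subr_ge0 in H2.
    have e : K + L * (r * s) = A * (r * r) + C * (s * s) + A * (r * s) + C * (s * r)
       + (Lr - Ls) * (v - u) - 2 * ((r + s) ^+ 2 / (v + u)).
      by rewrite /K /L; field; lra.
    rewrite e da dc da' dc'; rewrite opprK in H2; lra.
rewrite -subr_ge0 => H; apply: le_trans H _.
rewrite le_eqVlt; apply/orP; left; apply/eqP.
by rewrite /K /L ea ec; field; lra.
Qed.

(** A discrete form of: phi' x >= 2 c x implies phi 1 - phi x >= c (1 - x^2).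
    Cutting [x, y] into m + 1 equal pieces leaves an error c (y - x)^2 / (m + 1).
    Increments take the place of derivatives because the entropy below depends
    on a norm that may vanish. *)
Lemma quadratic_growth (phi : R -> R) c : 0 <= c ->
  (forall x y, 0 <= x -> x <= y -> y <= 1 ->
     2 * c * x * (y - x) <= phi y - phi x) ->
  forall x, 0 <= x -> x <= 1 -> c * (1 - x ^+ 2) <= phi 1 - phi x.
Proof.
move=> c0 H x x0 x1.
have step m : forall y, x <= y -> y <= 1 ->
    c * (y ^+ 2 - x ^+ 2 - (y - x) ^+ 2 / (m.+1)%:R) <= phi y - phi x.
  elim: m => [|m IH] y xy y1.
    by have := H x y x0 xy y1; rewrite divr1; nra.
  have m0 : 0 < m.+1%:R :> R by rewrite ltr0n.
  have m1 : 0 < m.+2%:R :> R by rewrite ltr0n.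
  have em : m.+2%:R = m.+1%:R + 1 :> R by rewrite -natr1.
  (* The first m + 1 of the m + 2 pieces make up [x, z]. *)
  pose z := x + (m.+1%:R / m.+2%:R) * (y - x).
  have q0 : 0 <= m.+1%:R / m.+2%:R :> R by rewrite divr_ge0// ltW.
  have q1 : m.+1%:R / m.+2%:R <= 1 :> R by rewrite ler_pdivrMr// mul1r em; lra.
  have xz : x <= z by rewrite /z lerDl mulr_ge0//; lra.
  have zy : z <= y.
    rewrite -subr_ge0.
    have -> : y - z = (1 - m.+1%:R / m.+2%:R) * (y - x) by rewrite /z; ring.
    by rewrite mulr_ge0// subr_ge0.
  have := IH z xz (le_trans zy y1).
  have := H z y (le_trans x0 xz) zy y1.
  move=> h1 h2; have -> : phi y - phi x = (phi y - phi z) + (phi z - phi x) by ring.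
  apply: le_trans (lerD h1 h2).
  rewrite le_eqVlt; apply/orP; left; apply/eqP.
  rewrite /z em; move: m0; set M := m.+1%:R => m0.
  field; lra.
apply/ler_addgt0Pr => e e0.
pose m := Num.truncn (c * (1 - x) ^+ 2 / e).
have := step m 1 x1 (lexx 1); rewrite expr1n.
have : c * (1 - x) ^+ 2 / m.+1%:R <= e.
  rewrite ler_pdivrMr ?ltr0n// [e * _]mulrC -ler_pdivrMr//.
  by apply/ltW/truncnS_gt.
rewrite -[c * _ / _]mulrA; set q := (1 - x) ^+ 2 / _; lra.
Qed.

(** Moving two points symmetrically towards their midpoint by the factor rho
    lowers the total entropy.  Along this motion a tangent line bounds the
    entropy from below, and strong monotonicity of the gradient makes the slope
    of that line at least proportional to the parameter, so that
    [quadratic_growth] applies. *)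
Lemma psi_two_point a b v c d u rho : nrm2 a b < v -> nrm2 c d < u ->
  0 <= rho -> rho <= 1 ->
  let mix x y := (1 + rho) / 2 * x + (1 - rho) / 2 * y in
  (1 - rho ^+ 2) * nrm2 ((a - c) / 2) ((b - d) / 2) ^+ 2 / ((v + u) / 2) <=
  psi (nrm2 a b) v + psi (nrm2 c d) u
  - psi (nrm2 (mix a c) (mix b d)) (mix v u)
  - psi (nrm2 (mix c a) (mix d b)) (mix u v).
Proof.
move=> h k rho0 rho1.
pose mx (x : R) y z := (1 + x) / 2 * y + (1 - x) / 2 * z.
pose phi x := psi (nrm2 (mx x a c) (mx x b d)) (mx x v u) +
              psi (nrm2 (mx x c a) (mx x d b)) (mx x u v).
pose K := nrm2 ((a - c) / 2) ((b - d) / 2) ^+ 2 / ((v + u) / 2).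
have r0 := nrm2_ge0 a b; have s0 := nrm2_ge0 c d.
have vu : 0 < v + u by lra.
have K0 : 0 <= K by rewrite /K divr_ge0 ?sqr_ge0//; lra.
have cone x : 0 <= x -> x <= 1 -> nrm2 (mx x a c) (mx x b d) < mx x v u.
  move=> x0 x1; apply: le_lt_trans (nrm2_triangle _ _ _ _) _.
  rewrite !nrm2Z !ger0_norm; [|lra|lra]; rewrite /mx.
  by nra.
have cone' x : 0 <= x -> x <= 1 -> nrm2 (mx x c a) (mx x d b) < mx x u v.
  move=> x0 x1; apply: le_lt_trans (nrm2_triangle _ _ _ _) _.
  rewrite !nrm2Z !ger0_norm; [|lra|lra]; rewrite /mx.
  by nra.
have := @quadratic_growth phi K K0.
have P x y : 0 <= x -> x <= y -> y <= 1 -> 2 * K * x * (y - x) <= phi y - phi x.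
  move=> x0 xy y1.
  have T1 := psi_nrm2_tangent (cone y ltac:(lra) y1) (cone x x0 ltac:(lra)).
  have T2 := psi_nrm2_tangent (cone' y ltac:(lra) y1) (cone' x x0 ltac:(lra)).
  have M := psi_nrm2_strong_mono (cone x x0 ltac:(lra)) (cone' x x0 ltac:(lra)).
  rewrite /phi.
  set A := gslope _ _ _ in T1 M; set C := gslope _ _ _ in T2 M.
  set LA := level _ _ in T1 M; set LC := level _ _ in T2 M.
  set p1 := psi _ _ in T1; set p2 := psi _ _ in T2.
  set p1' := psi _ _ in T1 *; set p2' := psi _ _ in T2 *.
  set G := A * (mx x a c * (a - c) + mx x b d * (b - d))
    - C * (mx x c a * (a - c) + mx x d b * (b - d)) + (LA - LC) * (v - u).
  (* G / 2 is the derivative of phi at x. *)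
  have S1 : (y - x) / 2 * G <= p1' + p2' - (p1 + p2).
    suff -> : (y - x) / 2 * G =
     (A * (mx x a c * (mx y a c - mx x a c) + mx x b d * (mx y b d - mx x b d)) +
       LA * (mx y v u - mx x v u)) +
     (C * (mx x c a * (mx y c a - mx x c a) + mx x d b * (mx y d b - mx x d b)) +
       LC * (mx y u v - mx x u v)) by lra.
    by rewrite /G /mx; field.
  have S2 : 4 * K * x ^+ 2 <= x * G.
    have -> : x * G = (A * mx x a c - C * mx x c a) * (mx x a c - mx x c a) +
     (A * mx x b d - C * mx x d b) * (mx x b d - mx x d b) +
     (LA - LC) * (mx x v u - mx x u v) by rewrite /G /mx; field.
    apply: le_trans M; rewrite le_eqVlt; apply/orP; left; apply/eqP.
    rewrite /K !nrm2_sqr /mx; field.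
    by apply/andP; split; lra.
  apply: le_trans S1.
  have [x_0|xn] := eqVneq x 0.
    rewrite [2 * K * x]mulrC {1}x_0 !mul0r.
    (* At x = 0 the two points coincide and the derivative vanishes. *)
    have e (z w : R) : mx 0 z w = mx 0 w z by rewrite /mx; field.
    suff -> : G = 0 by rewrite mulr0.
    by rewrite /G /A /C /LA /LC x_0 !(e c a, e d b, e u v); ring.
  have S3 : 4 * K * x <= G by rewrite -(ler_pM2l (_ : 0 < x)); [lra|lra].
  by nra.
move/(_ P rho rho0 rho1).
have -> : phi 1 = psi (nrm2 a b) v + psi (nrm2 c d) u.
  by rewrite /phi /mx; congr (psi (nrm2 _ _) _ + psi (nrm2 _ _) _); field.
rewrite /K /phi /mx mulrAC mulrC => H; lra.
Qed.
End Entropy.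

(** * Noise, entropy and Fisher information on the cube *)

Section Cube.
Variables (R : realType) (n : nat).
Implicit Types (h w v f g : cube n -> R) (x : cube n) (i j : 'I_n) (rho : R).

Definition flip x j : cube n := cmul x (cflip j).

Lemma flipK j : involutive (flip^~ j).
Proof. exact: cmulK. Qed.

Lemma flipC x i j : flip (flip x i) j = flip (flip x j) i.
Proof. by apply/ffunP => k; rewrite !ffunE addbAC. Qed.

Definition mean h : R := (\sum_x h x) / 2 ^+ n.

Lemma le_mean h g : (forall x, h x <= g x) -> mean h <= mean g.
Proof.
by move=> H; rewrite ler_pM2r ?invr_gt0 ?exprn_gt0//; apply: ler_sum => x _.
Qed.

Lemma eq_mean h g : h =1 g -> mean h = mean g.
Proof. by move=> H; congr (_ / _); apply: eq_bigr. Qed.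

Lemma meanD h g : mean (fun x => h x + g x) = mean h + mean g.
Proof. by rewrite /mean big_split mulrDl. Qed.

Lemma meanZ (c : R) h : mean (fun x => c * h x) = c * mean h.
Proof. by rewrite /mean -mulr_sumr mulrA. Qed.

Lemma meanB h g : mean (fun x => h x - g x) = mean h - mean g.
Proof. by rewrite /mean sumrB mulrBl. Qed.

Lemma mean_sum (I : Type) (r : seq I) (P : pred I) (F : I -> cube n -> R) :
  mean (fun x => \sum_(k <- r | P k) F k x) = \sum_(k <- r | P k) mean (F k).
Proof. by rewrite /mean exchange_big mulr_suml. Qed.

Lemma mean_cst (c : R) : mean (fun=> c) = c.
Proof.
rewrite /mean sumr_const card_ffun card_bool card_ord -[c *+ _]mulr_natr natrX mulfK//.
Qed.

Lemma mean_flip h j : mean (fun x => h (flip x j)) = mean h.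
Proof.
by congr (_ / _); rewrite [RHS](reindex_inj (inv_inj (flipK j))).
Qed.

Lemma mean_gt0 h : (forall x, 0 < h x) -> 0 < mean h.
Proof.
move=> H; rewrite divr_gt0 ?exprn_gt0//; apply: (@lt_le_trans _ _ (h [ffun=> false])) => //.
by rewrite (bigD1 [ffun=> false])//= lerDl sumr_ge0// => x _; rewrite ltW.
Qed.

(** Conditional expectation when the j-th sign is replaced by its opposite with
    probability (1 - rho) / 2. *)
Definition noise1 rho j h : cube n -> R :=
  fun x => (1 + rho) / 2 * h x + (1 - rho) / 2 * h (flip x j).
Definition hdiff j h : cube n -> R := fun x => (h x - h (flip x j)) / 2.
Definition havg j h : cube n -> R := fun x => (h x + h (flip x j)) / 2.
Definition noise_seq rho (s : seq 'I_n) h := foldr (noise1 rho) h s.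

Lemma hdiff_noise1 rho j i h :
  hdiff i (noise1 rho j h) =1 noise1 rho j (hdiff i h).
Proof. by move=> x; rewrite /hdiff /noise1 [flip (flip _ i) j]flipC; field. Qed.

Lemma havg_noise1 rho j i h :
  havg i (noise1 rho j h) =1 noise1 rho j (havg i h).
Proof. by move=> x; rewrite /havg /noise1 [flip (flip _ i) j]flipC; field. Qed.

Lemma hdiff_noise1_id rho j h :
  hdiff j (noise1 rho j h) =1 (fun x => rho * hdiff j h x).
Proof. by move=> x; rewrite /hdiff /noise1 flipK; field. Qed.

Lemma havg_noise1_id rho j h : havg j (noise1 rho j h) =1 havg j h.
Proof. by move=> x; rewrite /havg /noise1 flipK; field. Qed.

Lemma mean_noise1 rho j h : mean (noise1 rho j h) = mean h.
Proof.
by rewrite /noise1 meanD !meanZ mean_flip; field.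
Qed.

Lemma mean_noise_seq rho s h : mean (noise_seq rho s h) = mean h.
Proof. by elim: s => //= j s IH; rewrite mean_noise1. Qed.

(** The average of v over coordinate j is used in the denominator, not v itself:
    this is the smaller quantity, and the one that the two-point inequality
    controls. *)
Definition fisher j w1 w2 v :=
  mean (fun x => (hdiff j w1 x ^+ 2 + hdiff j w2 x ^+ 2) / havg j v x).

Lemma sqr_div_convex (p q a b x y : R) : 0 <= p -> 0 <= q -> 0 < x -> 0 < y ->
  0 < p * x + q * y ->
  (p * a + q * b) ^+ 2 / (p * x + q * y) <= p * (a ^+ 2 / x) + q * (b ^+ 2 / y).
Proof.
move=> p0 q0 x0 y0 s0; rewrite -subr_ge0.
have -> : p * (a ^+ 2 / x) + q * (b ^+ 2 / y) -
    (p * a + q * b) ^+ 2 / (p * x + q * y) =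
    p * q * (a * y - b * x) ^+ 2 / (x * y * (p * x + q * y)).
  by field; lra.
have xy0 : 0 <= x * y * (p * x + q * y) by rewrite !mulr_ge0// ltW.
by rewrite divr_ge0// mulr_ge0 ?sqr_ge0// mulr_ge0.
Qed.

(** Noise commutes with differences and averages in coordinate i, and
    (x, y) |-> x^2 / y is jointly convex. *)
Lemma fisher_noise1 rho i j w1 w2 v : 0 <= rho -> rho <= 1 ->
  (forall x, 0 < v x) ->
  fisher i (noise1 rho j w1) (noise1 rho j w2) (noise1 rho j v) <= fisher i w1 w2 v.
Proof.
move=> r0 r1 v0; rewrite /fisher -[leRHS](mean_noise1 rho j).
apply: le_mean => x; rewrite !hdiff_noise1 havg_noise1 /noise1 !mulrDl.
have m0 y : 0 < havg i v y by rewrite divr_gt0// addr_gt0.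
have := m0 x; have := m0 (flip x j).
set p := havg _ _ _; set q := havg _ _ _ => p0 q0.
rewrite !mulrDr.
have s0 : 0 < (1 + rho) / 2 * q + (1 - rho) / 2 * p.
  have : 0 < (1 + rho) / 2 * q by rewrite mulr_gt0//; lra.
  have : 0 <= (1 - rho) / 2 * p by rewrite mulr_ge0//; lra.
  lra.
rewrite -!mulrDl.
have h1 := @sqr_div_convex ((1 + rho) / 2) ((1 - rho) / 2) (hdiff i w1 x)
  (hdiff i w1 (flip x j)) q p ltac:(lra) ltac:(lra) q0 p0 s0.
have h2 := @sqr_div_convex ((1 + rho) / 2) ((1 - rho) / 2) (hdiff i w2 x)
  (hdiff i w2 (flip x j)) q p ltac:(lra) ltac:(lra) q0 p0 s0.
lra.
Qed.

(** Positivity of the matrix that [psi] is evaluated on. *)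
Definition cone w1 w2 v := forall x, nrm2 (w1 x) (w2 x) < v x.

Lemma cone_gt0 w1 w2 v : cone w1 w2 v -> forall x, 0 < v x.
Proof. by move=> H x; apply: le_lt_trans (H x); exact: nrm2_ge0. Qed.

Lemma cone_noise1 rho j w1 w2 v : 0 <= rho -> rho <= 1 -> cone w1 w2 v ->
  cone (noise1 rho j w1) (noise1 rho j w2) (noise1 rho j v).
Proof.
move=> r0 r1 H x; apply: le_lt_trans (nrm2_triangle _ _ _ _) _.
rewrite !nrm2Z !ger0_norm; [|lra|lra]; rewrite /noise1.
have := H x; have := H (flip x j); nra.
Qed.

Lemma cone_noise_seq rho s w1 w2 v : 0 <= rho -> rho <= 1 -> cone w1 w2 v ->
  cone (noise_seq rho s w1) (noise_seq rho s w2) (noise_seq rho s v).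
Proof. by move=> r0 r1 H; elim: s => //= j s IH; exact: cone_noise1. Qed.

Definition entropy w1 w2 v := mean (fun x => psi (nrm2 (w1 x) (w2 x)) (v x)).

Lemma entropy_noise1 rho j w1 w2 v : 0 <= rho -> rho <= 1 -> cone w1 w2 v ->
  (1 - rho ^+ 2) * fisher j w1 w2 v <=
  2 * (entropy w1 w2 v - entropy (noise1 rho j w1) (noise1 rho j w2) (noise1 rho j v)).
Proof.
move=> r0 r1 H; rewrite /entropy mulrBr [2 * mean _]mulrC [2 * mean _]mulrC.
set P := fun x => psi _ _; set Q := fun x => psi _ _.
have -> : mean P * 2 - mean Q * 2 =
    mean (fun x => P x + P (flip x j) - Q x - Q (flip x j)).
  move: P Q => P Q.
  by rewrite !meanB meanD !mean_flip; ring.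
rewrite /fisher -meanZ; apply: le_mean => x; rewrite -nrm2_sqr mulrA.
apply: le_trans (psi_two_point (H x) (H (flip x j)) r0 r1) _.
by rewrite /P /Q /noise1 flipK.
Qed.

(** Adding noise in one more coordinate j costs the entropy that
    [entropy_noise1] bounds below by the information of coordinate j, and does
    not increase the information of the others. *)
Lemma fisher_noise_seq rho s w1 w2 v : 0 <= rho -> rho <= 1 -> cone w1 w2 v ->
  (1 - rho ^+ 2) *
    \sum_(j <- s) fisher j
      (noise_seq rho s w1) (noise_seq rho s w2) (noise_seq rho s v) <=
  2 * rho ^+ 2 * (entropy w1 w2 v -
    entropy (noise_seq rho s w1) (noise_seq rho s w2) (noise_seq rho s v)).
Proof.
move=> r0 r1 H.
have rr : 0 <= 1 - rho ^+ 2 by nra.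
elim: s => [|j s IH]; first by rewrite big_nil mulr0 subrr mulr0.
rewrite big_cons /=.
have cs := cone_noise_seq s r0 r1 H.
have := entropy_noise1 j r0 r1 cs.
move: IH cs.
set p1 := noise_seq rho s w1; set p2 := noise_seq rho s w2; set q := noise_seq rho s v.
move=> IH cs E1.
have -> : fisher j (noise1 rho j p1) (noise1 rho j p2) (noise1 rho j q) =
    rho ^+ 2 * fisher j p1 p2 q.
  rewrite /fisher -meanZ; apply: eq_mean => x.
  by rewrite !hdiff_noise1_id havg_noise1_id !exprMn -mulrDr mulrA.
(* The information of the coordinates treated before decreases. *)
have E2 : \sum_(i <- s) fisher i (noise1 rho j p1) (noise1 rho j p2) (noise1 rho j q)
    <= \sum_(i <- s) fisher i p1 p2 q.
  by apply: ler_sum => i _; apply: fisher_noise1 => //; exact: cone_gt0 cs.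
have := ler_wpM2l rr E2; have := ler_wpM2l (sqr_ge0 rho) E1.
lra.
Qed.

(** Jensen's inequality: the minimum of [psi] for trace u is attained at r = 0,
    where both eigenvalues are u / 2. *)
Lemma entropy_ge w1 w2 v : cone w1 w2 v ->
  mean v * ln (mean v / 2) <= entropy w1 w2 v.
Proof.
move=> H; set u := mean v.
have u0 : 0 < u by apply: mean_gt0; exact: cone_gt0 H.
have -> : u * ln (u / 2) = mean (fun x => psi 0 u + level 0 u * (v x - u)).
  rewrite meanD meanZ meanB !mean_cst subrr mulr0 addr0 /psi /xlnx addr0 subr0.
  by field.
apply: le_mean => x.
have := @psi_tangent R (nrm2 (w1 x) (w2 x)) (v x) 0 u.
rewrite ger0_norm ?nrm2_ge0// normr0 => /(_ (H x) u0).
by rewrite slope0 mul0r addr0.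
Qed.

Lemma young_pair (a b c d m k : R) : 0 < m -> 0 < k ->
  2 * (a * c + b * d) <= k * ((a ^+ 2 + b ^+ 2) * m) + (c ^+ 2 + d ^+ 2) / m / k.
Proof.
move=> m0 k0; rewrite -subr_ge0.
have -> : k * ((a ^+ 2 + b ^+ 2) * m) + (c ^+ 2 + d ^+ 2) / m / k - 2 * (a * c + b * d)
  = ((k * m * a - c) ^+ 2 + (k * m * b - d) ^+ 2) / (m * k) by field; lra.
by rewrite divr_ge0 ?addr_ge0 ?sqr_ge0// mulr_ge0// ltW.
Qed.

(** Young's inequality with weight M_j v for each j.  The squared difference of f
    in coordinate j is invariant under the flip of j, so M_j v may be replaced
    by v once the mean is taken, and the sum over j recovers the gradient. *)
Lemma energy_le_fisher f1 f2 w1 w2 v (g k : R) : (forall x, 0 < v x) ->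
  (forall x, \sum_j (hdiff j f1 x ^+ 2 + hdiff j f2 x ^+ 2) <= g) -> 0 < k ->
  2 * mean (fun x => \sum_j (hdiff j f1 x * hdiff j w1 x + hdiff j f2 x * hdiff j w2 x))
  <= k * (g * mean v) + (\sum_j fisher j w1 w2 v) / k.
Proof.
move=> v0 G k0.
pose U j x := hdiff j f1 x ^+ 2 + hdiff j f2 x ^+ 2.
have -> : 2 * mean (fun x =>
     \sum_j (hdiff j f1 x * hdiff j w1 x + hdiff j f2 x * hdiff j w2 x))
   = \sum_j mean (fun x =>
       2 * (hdiff j f1 x * hdiff j w1 x + hdiff j f2 x * hdiff j w2 x)).
  by rewrite mean_sum mulr_sumr; apply: eq_bigr => j _; rewrite meanZ.
have -> : (\sum_j fisher j w1 w2 v) / k = \sum_j fisher j w1 w2 v / k by rewrite mulr_suml.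
(* Invariance of U j under the flip of j moves the average away from v. *)
have UM j : mean (fun x => U j x * havg j v x) = mean (fun x => U j x * v x).
  have <- : mean (fun x => (U j x * v x + U j (flip x j) * v (flip x j)) / 2) =
     mean (fun x => U j x * v x).
    rewrite (@eq_mean _ (fun x => 2^-1 * (U j x * v x + U j (flip x j) * v (flip x j)))).
      by rewrite meanZ meanD (mean_flip (fun x => U j x * v x)); field.
    by move=> x; rewrite mulrC.
  by apply: eq_mean => x; rewrite /U /havg /hdiff flipK; field.
have -> : k * (g * mean v) = k * mean (fun x => g * v x) by rewrite meanZ.
apply: (@le_trans _ _ (k * (\sum_j mean (fun x => U j x * v x)) + \sum_j fisher j w1 w2 v / k)).
  rewrite mulr_sumr -big_split /=; apply: ler_sum => j _.
  rewrite -UM -meanZ /fisher [_ / k]mulrC -meanZ -meanD; apply: le_mean => x.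
  rewrite [k^-1 * _]mulrC; apply: young_pair => //.
  by rewrite divr_gt0// addr_gt0.
rewrite lerD2r; apply: ler_wpM2l; first exact: ltW.
rewrite -mean_sum; apply: le_mean => x; rewrite -mulr_suml.
by apply: ler_wpM2r; [exact: ltW|exact: G].
Qed.

Definition noise rho h := noise_seq rho (index_enum 'I_n) h.

(** The parameter of Young's inequality is proportional to
    rho / sqrt (1 - rho^2), which balances the factor of [fisher_noise_seq] and
    leaves a free parameter k that does not depend on rho. *)
Lemma energy_noise_le_entropy f1 f2 w1 w2 v (g k rho : R) : cone w1 w2 v ->
  (forall x, \sum_j (hdiff j f1 x ^+ 2 + hdiff j f2 x ^+ 2) <= g) ->
  0 < k -> 0 < rho -> rho < 1 ->
  2 * mean (fun x => \sum_j (hdiff j f1 x * hdiff j (noise rho w1) x +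
                             hdiff j f2 x * hdiff j (noise rho w2) x))
  <= rho / Num.sqrt (1 - rho ^+ 2) *
     (k * (g * mean v) + 2 / k * (entropy w1 w2 v - mean v * ln (mean v / 2))).
Proof.
move=> H G k0 r0 r1; set c := rho / _.
have rr : 0 < 1 - rho ^+ 2 by nra.
have sr : 0 < Num.sqrt (1 - rho ^+ 2) by rewrite sqrtr_gt0.
have c0 : 0 < c by rewrite divr_gt0.
have cT := cone_noise_seq (index_enum 'I_n) (ltW r0) (ltW r1) H.
have := energy_le_fisher (noise rho w1) (noise rho w2) (cone_gt0 cT) G (mulr_gt0 c0 k0).
move=> E1; apply: le_trans E1 _.
have E0 := entropy_ge cT.
have F := fisher_noise_seq (index_enum 'I_n) (ltW r0) (ltW r1) H.
rewrite mean_noise_seq in E0 *.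
set S := \sum_j _ in F *.
have {}F : S <= 2 * c ^+ 2 * (entropy w1 w2 v - mean v * ln (mean v / 2)).
  rewrite /c expr_div_n sqr_sqrtr; last exact: ltW.
  set e := entropy _ _ _ - _.
  have -> : 2 * (rho ^+ 2 / (1 - rho ^+ 2)) * e = 2 * rho ^+ 2 * e / (1 - rho ^+ 2).
    by field; lra.
  rewrite ler_pdivlMr// [S * _]mulrC.
  apply: le_trans F _; apply: ler_wpM2l; last by rewrite /e; lra.
  by rewrite mulr_ge0// sqr_ge0.
rewrite [c * (_ + _)]mulrDr [c * (k * _)]mulrA lerD2l ler_pdivrMr; last exact: mulr_gt0.
apply: le_trans F _; rewrite le_eqVlt; apply/orP; left; apply/eqP.
by field; lra.
Qed.

End Cube.

(** * Walsh coefficients *)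

Section Walsh.
Variables (R : realType) (n : nat).
Implicit Types (h w f g : cube n -> R) (x : cube n) (j : 'I_n) (A : {set 'I_n}).

Lemma Re_sum (I : Type) (r : seq I) (P : pred I) (F : I -> R[i]) :
  complex.Re (\sum_(k <- r | P k) F k) = \sum_(k <- r | P k) complex.Re (F k).
Proof. by apply: big_morph => // -[a b] [c d]. Qed.

Lemma Im_sum (I : Type) (r : seq I) (P : pred I) (F : I -> R[i]) :
  complex.Im (\sum_(k <- r | P k) F k) = \sum_(k <- r | P k) complex.Im (F k).
Proof. by apply: big_morph => // -[a b] [c d]. Qed.

Lemma ReMr (z : R[i]) (r : R) : complex.Re (z * r%:C) = complex.Re z * r.
Proof. by case: z => a b /=; rewrite mulr0 subr0. Qed.

Lemma ImMr (z : R[i]) (r : R) : complex.Im (z * r%:C) = complex.Im z * r.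
Proof. by case: z => a b /=; rewrite mulr0 add0r. Qed.

Lemma ReB (z w : R[i]) : complex.Re (z - w) = complex.Re z - complex.Re w.
Proof. by case: z => a b; case: w. Qed.

Lemma ImB (z w : R[i]) : complex.Im (z - w) = complex.Im z - complex.Im w.
Proof. by case: z => a b; case: w. Qed.

Lemma cabsE (z : R[i]) : cabs z = nrm2 (complex.Re z) (complex.Im z).
Proof. by case: z. Qed.

Lemma ExE (f : cube n -> R[i]) :
  complex.Re (Ex f) = mean (fun x => complex.Re (f x)) /\
  complex.Im (Ex f) = mean (fun x => complex.Im (f x)).
Proof.
have e : (2 ^+ n)^-1 = ((2 ^+ n)^-1)%:C :> R[i].
  by rewrite fmorphV rmorphXn /= rmorphMn.
by rewrite /Ex e ReMr ImMr Re_sum Im_sum.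
Qed.

Definition walshR A x : R := \prod_(j in A) (-1) ^+ x j.

Lemma walshRE A x : walsh R A x = (walshR A x)%:C.
Proof.
rewrite /walshR rmorph_prod; apply: eq_bigr => j _.
by rewrite rmorphXn rmorphN rmorph1.
Qed.

Lemma walshR_flip A x j :
  walshR A (flip x j) = if j \in A then - walshR A x else walshR A x.
Proof.
have := walsh_cmul R A x (cflip j); rewrite walsh_cflip -/(flip x j) !walshRE.
by case: ifP => _; [rewrite mulrN1 -rmorphN|rewrite mulr1] => -[].
Qed.

Definition coef h A := mean (fun x => h x * walshR A x).

Lemma dotp_walshE (f : cube n -> R[i]) A :
  complex.Re (dotp f (walsh R A)) = coef (fun x => complex.Re (f x)) A /\
  complex.Im (dotp f (walsh R A)) = coef (fun x => complex.Im (f x)) A.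
Proof.
have [e1 e2] := ExE (fun x => f x * conjc (walsh R A x)).
by split; rewrite /dotp ?e1 ?e2; apply: eq_mean => x;
  rewrite walsh_conj walshRE ?ReMr ?ImMr.
Qed.

Lemma walshR_expansion h x : h x = \sum_A coef h A * walshR A x.
Proof.
have := congr1 (@complex.Re R) (walsh_expansion (fun x => (h x)%:C) x).
rewrite /= Re_sum => ->; apply: eq_bigr => A _.
by rewrite walshRE ReMr (dotp_walshE _ _).1.
Qed.

Lemma parseval h g : mean (fun x => h x * g x) = \sum_A coef h A * coef g A.
Proof.
under eq_mean do rewrite {1}walshR_expansion mulr_suml.
rewrite mean_sum; apply: eq_bigr => A _.
by rewrite -meanZ; apply: eq_mean => x; ring.
Qed.

Lemma mean_flip_walshR j h A :
  mean (fun x => h (flip x j) * walshR A x) = (-1) ^+ (j \in A) * coef h A.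
Proof.
rewrite -(mean_flip _ j) -meanZ; apply: eq_mean => x.
by rewrite flipK walshR_flip; case: (j \in A); rewrite /= ?expr1 ?expr0; ring.
Qed.

Lemma coef_hdiff j h A : coef (hdiff j h) A = (j \in A)%:R * coef h A.
Proof.
rewrite /coef /hdiff.
under eq_mean do rewrite mulrAC mulrC mulrBl.
rewrite meanZ meanB mean_flip_walshR -/(coef h A).
by case: (j \in A); rewrite /= ?expr1 ?expr0; field.
Qed.

Lemma coef_noise1 rho j h A :
  coef (noise1 rho j h) A = rho ^+ (j \in A) * coef h A.
Proof.
rewrite /coef /noise1.
under eq_mean do rewrite mulrDl -!mulrA.
rewrite meanD !meanZ mean_flip_walshR -/(coef h A).
by case: (j \in A); rewrite /= ?expr1 ?expr0; field.
Qed.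

Lemma coef_noise rho h A : coef (noise rho h) A = rho ^+ #|A| * coef h A.
Proof.
have -> : #|A| = (\sum_(j : 'I_n) (j \in A))%N by rewrite -sum1_card big_mkcond.
rewrite /noise; elim: (index_enum 'I_n) => [|j s IH]; first by rewrite big_nil mul1r.
by rewrite /= coef_noise1 IH big_cons exprD mulrA.
Qed.

(** Both sides are the Dirichlet form of f and the noisy w: coordinate j sees
    exactly the sets A that contain j. *)
Lemma energy_walsh rho f w :
  mean (fun x => \sum_j hdiff j f x * hdiff j (noise rho w) x) =
  \sum_(A : {set 'I_n}) #|A|%:R * rho ^+ #|A| * (coef f A * coef w A).
Proof.
rewrite mean_sum.
under eq_bigr do rewrite parseval.
rewrite exchange_big; apply: eq_bigr => A _.
have -> : #|A|%:R = \sum_(j : 'I_n) (j \in A)%:R :> R.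
  by rewrite -natr_sum -sum1_card big_mkcond.
rewrite !mulr_suml; apply: eq_bigr => j _.
rewrite !coef_hdiff coef_noise.
by case: (j \in A); rewrite ?mul0r// !mul1r; ring.
Qed.

(** The fractional Laplacian has real coefficients in the Walsh basis, hence acts
    separately on real and imaginary parts. *)
Definition real_laplacian_pow (alpha : R) h x :=
  \sum_(A : {set 'I_n} | A != finset.set0)
    coef h A * ((4 * #|A|)%:R `^ alpha * walshR A x).

Lemma laplacian_powE alpha (f : cube n -> R[i]) x :
  complex.Re (laplacian_pow alpha f x) =
    real_laplacian_pow alpha (fun x => complex.Re (f x)) x /\
  complex.Im (laplacian_pow alpha f x) =
    real_laplacian_pow alpha (fun x => complex.Im (f x)) x.
Proof.
rewrite /laplacian_pow Re_sum Im_sum; split; apply: eq_bigr => A _;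
  by rewrite walshRE -rmorphM ?ReMr ?ImMr (dotp_walshE _ _).1 ||
     rewrite walshRE -rmorphM ?ReMr ?ImMr (dotp_walshE _ _).2.
Qed.

Lemma mean_real_laplacian_pow_mul alpha h w :
  mean (fun x => real_laplacian_pow alpha h x * w x) =
  \sum_(A : {set 'I_n} | A != finset.set0)
     (4 * #|A|)%:R `^ alpha * (coef h A * coef w A).
Proof.
rewrite /real_laplacian_pow; under eq_mean do rewrite mulr_suml.
rewrite mean_sum; apply: eq_bigr => A _.
rewrite mulrA -meanZ; apply: eq_mean => x; ring.
Qed.

Lemma laplacian_pow0 (f : cube n -> R[i]) x : laplacian_pow 0 f x = f x - Ex f.
Proof.
rewrite [in RHS](walsh_expansion f x) (bigD1 finset.set0)//=.
have -> : dotp f (walsh R finset.set0) * walsh R finset.set0 x = Ex f.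
  rewrite /walsh big_set0 mulr1 /dotp; congr (_ / _); apply: eq_bigr => y _.
  by rewrite big_set0 conjc1 mulr1.
rewrite addrAC subrr add0r; apply: eq_bigr => A A0.
by rewrite powRr0 mul1r.
Qed.

(** For j in A, the Walsh function of A is half of its own j-th difference, so
    the coefficient of f at A is a coefficient of the j-th difference of f. *)
Lemma laplacian_pow_const alpha (f : cube n -> R[i]) :
  (forall j x, partial j f x = 0) -> forall x, laplacian_pow alpha f x = 0.
Proof.
move=> H x; rewrite /laplacian_pow big1// => A /set0Pn[j jA].
suff -> : dotp f (walsh R A) = 0 by rewrite mul0r.
have : dotp (partial j f) (walsh R A) = 0.
  by rewrite /dotp /Ex big1 ?mul0r// => y _; rewrite H mul0r.
rewrite partial_adjoint.
have -> : dotp f (partial j (walsh R A)) = dotp f (walsh R A) * 2.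
  rewrite /dotp /Ex mulrAC; congr (_ / _); rewrite mulr_suml.
  apply: eq_bigr => y _; rewrite /partial walsh_cmul walsh_cflip jA mulrN1 opprK.
  by rewrite -mulr2n raddfMn mulrnAr mulr_natr.
by move/eqP; rewrite mulf_eq0 pnatr_eq0 orbF => /eqP.
Qed.

End Walsh.

(** * The Gamma integral in the angle variable *)

Section GammaNoise.
Variable R : realType.
Local Notation mu := (@lebesgue_measure R).
Implicit Types (a b c d p x y s t theta : R).

Definition nlncos theta : R := - ln (cos theta).

Section at_angle.
Variables (theta : R) (th : 0 < theta < pi / 2).

Lemma cos_gt0_acute : 0 < cos theta.
Proof.
by case/andP: th => h1 h2; apply: cos_gt0_pihalf; have := @pi_gt0 R; lra.
Qed.

Lemma sin_gt0_acute : 0 < sin theta.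
Proof.
by case/andP: th => h1 h2; apply: sin_gt0_pi; have := @pi_gt0 R; lra.
Qed.

Lemma cos_lt1_acute : cos theta < 1.
Proof.
have := cos2Dsin2 theta; have := sin_gt0_acute; have := cos_gt0_acute; nra.
Qed.

Lemma nlncos_gt0 : 0 < nlncos theta.
Proof. by rewrite oppr_gt0 ln_lt0// cos_gt0_acute cos_lt1_acute. Qed.

Lemma is_derive_nlncos : is_derive theta 1 nlncos (sin theta / cos theta).
Proof.
have h : is_derive (cos theta) 1 (@ln R) (cos theta)^-1.
  exact: is_derive1_ln cos_gt0_acute.
have h2 : is_derive theta 1 (fun x => ln (cos x)) ((cos theta)^-1 *: (- sin theta)).
  exact: is_derive1_comp.
rewrite /nlncos; apply: is_derive_eq.
by rewrite /GRing.scale /= mulrN opprK mulrC.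
Qed.

Lemma is_derive_nlncos_powR p :
  is_derive theta 1 (fun x => nlncos x `^ p)
    (p * nlncos theta `^ (p - 1) * (sin theta / cos theta)).
Proof.
have h := is_derive1_powR p nlncos_gt0.
have h1 := is_derive_nlncos.
exact: (@is_derive1_comp _ (fun x => x `^ p) nlncos).
Qed.

Lemma derivable_kernel p (k : nat) :
  derivable (fun x => nlncos x `^ p * (k%:R * cos x ^+ k * (sin x / cos x))) theta 1.
Proof.
have h1 := is_derive_nlncos_powR p.
have c0 : cos theta != 0 by rewrite gt_eqF// cos_gt0_acute.
have h2 : is_derive theta 1 (fun x => (cos x)^-1) (- (cos theta) ^- 2 *: (- sin theta)).
  exact: is_deriveV.
have dc : derivable (@cos R) theta 1 by case: (is_derive_cos theta).
have ds : derivable (@sin R) theta 1 by case: (is_derive_sin theta).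
pose f1 : R -> R := fun x => nlncos x `^ p.
pose f2 : R -> R := fun=> k%:R.
pose f3 : R -> R := @cos R ^+ k.
pose f4 : R -> R := @sin R.
pose f5 : R -> R := fun x => (cos x)^-1.
have -> : (fun x => nlncos x `^ p * (k%:R * cos x ^+ k * (sin x / cos x))) =
  f1 * (f2 * f3 * (f4 * f5)).
  by apply/funext => x; rewrite /f3 /= !fctE.
have d1 : derivable f1 theta 1 by case: h1.
have d2 : derivable f2 theta 1 by exact: derivable_cst.
have d3 : derivable f3 theta 1 by exact: (@derivableX _ _ (@cos R) k theta 1 dc).
have d5 : derivable f5 theta 1 by case: h2.
have d45 := @derivableM _ _ f4 f5 theta 1 ds d5.
have d23 := @derivableM _ _ f2 f3 theta 1 d2 d3.
have d2345 := @derivableM _ _ _ _ theta 1 d23 d45.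
exact: (@derivableM _ _ _ _ theta 1 d1 d2345).
Qed.

End at_angle.

Lemma acos_expR_acute s : 0 < s -> 0 < acos (expR (- s)) < pi / 2.
Proof.
move=> s0.
have e0 : 0 < expR (- s) by exact: expR_gt0.
have e1 : expR (- s) < 1 by rewrite expR_lt1; lra.
have h : -1 <= expR (- s) <= 1 by apply/andP; split; lra.
apply/andP; split; first by apply: acos_gt0; apply/andP; split; lra.
have p0 := @pi_gt0 R.
have <- : (cos (pi / 2) < cos (acos (expR (- s)))) = (acos (expR (- s)) < pi / 2).
  by apply: ltr_cos; rewrite in_itv/= ?acos_ge0 ?acos_lepi//; apply/andP; split; lra.
by rewrite cos_pihalf acosK.
Qed.

Lemma nlncos_acos s : 0 < s -> nlncos (acos (expR (- s))) = s.
Proof.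
move=> s0; rewrite /nlncos acosK; first by rewrite expRK opprK.
rewrite in_itv/=; have := expR_gt0 (- s).
have : expR (- s) < 1 by rewrite expR_lt1; lra.
by move=> h1 h2; apply/andP; split; lra.
Qed.

Lemma nlncos_homo x y : 0 < x -> x < y -> y < pi / 2 -> nlncos x < nlncos y.
Proof.
move=> x0 xy yp; rewrite /nlncos ltrN2 ltr_ln ?posrE ?cos_gt0_acute//.
- by rewrite ltr_cos// in_itv/=; apply/andP; split; have := @pi_gt0 R; lra.
- by rewrite yp (lt_trans x0).
- by rewrite x0 (lt_trans xy).
Qed.

Lemma acos_expR_homo a b : 0 < a -> a <= b -> acos (expR (- a)) <= acos (expR (- b)).
Proof.
move=> a0 ab; have b0 := lt_le_trans a0 ab.
have /andP[h1 h2] := acos_expR_acute a0; have /andP[h3 h4] := acos_expR_acute b0.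
rewrite leNgt; apply/negP => h; have := nlncos_homo h3 h h2.
by rewrite !nlncos_acos//; lra.
Qed.

Definition gamma_integrand p (u : R) := u `^ p * expR (- u).

(** The substitution u = k (- ln cos x), which maps the angle acos (exp (- s)) to
    k s.  Compact intervals inside the open quarter turn keep every function
    smooth; the endpoints are reached by a limit in [gamma_trunc_cvg]. *)
Lemma gamma_subst p (k : nat) a b : (0 < k)%N -> 0 < a -> a <= b ->
  (\int[mu]_(u in `[k%:R * a, k%:R * b]) gamma_integrand p u)%R =
  k%:R `^ p * (\int[mu]_(x in `[acos (expR (- a)), acos (expR (- b))])
     (nlncos x `^ p * (k%:R * cos x ^+ k * (sin x / cos x))))%R.
Proof.
move=> k0 a0 ab; have b0 := lt_le_trans a0 ab.
have k1 : 0 < k%:R :> R by rewrite ltr0n.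
set c := acos _; set d := acos _.
have cd : c <= d by exact: acos_expR_homo.
have /andP[c0 c1] : 0 < c < pi / 2 by exact: acos_expR_acute.
have /andP[d0 d1] : 0 < d < pi / 2 by exact: acos_expR_acute.
pose F x := k%:R * nlncos x.
have acute x : x \in `[c, d] -> 0 < x < pi / 2.
  by rewrite in_itv/= => /andP[h1 h2]; apply/andP; split; lra.
have dF x : 0 < x < pi / 2 -> is_derive x 1 F (k%:R * (sin x / cos x)).
  move=> h; have := is_derive_nlncos h => h1.
  by rewrite /F; apply: is_derive_eq.
have dF1 x : 0 < x < pi / 2 -> derive1 F x = k%:R * (sin x / cos x).
  by move=> h; rewrite derive1E; have := dF _ h => h1; rewrite derive_val.
have cF1 x : 0 < x < pi / 2 -> {for x, continuous (derive1 F)}.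
  move=> h; have x0 : cos x != 0 by rewrite gt_eqF// cos_gt0_acute.
  have : {for x, continuous (fun y => k%:R * (sin y / cos y))}.
    apply: continuousM; first exact: cst_continuous.
    by apply: continuousM; [exact: continuous_sin|apply: continuousV => //; exact: continuous_cos].
  rewrite /prop_for /continuous_at dF1//; apply: cvg_trans.
  apply: near_eq_cvg.
  have : \forall y \near x, y \in `]0, pi / 2[ by apply: near_in_itvoo; rewrite in_itv.
  by apply: filterS => y; rewrite in_itv/= => /dF1 ->.
have -> : k%:R * a = F c by rewrite /F nlncos_acos.
have -> : k%:R * b = F d by rewrite /F nlncos_acos.
have hc : c \in `[c, d] by rewrite in_itv/= lexx cd.
have hd : d \in `[c, d] by rewrite in_itv/= lexx cd.
have contF x : x \in `[c, d] -> {for x, continuous F}.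
  move=> /acute/dF h; apply: differentiable_continuous.
  by apply/derivable1_diffP; case: h.
rewrite /Rintegral integration_by_substitution_increasing//.
- rewrite -[RHS]/(k%:R `^ p * \int[mu]_(x in _) _)%R.
  rewrite -RintegralZl//; last first.
    apply: continuous_compact_integrable; first exact: segment_compact.
    by apply: derivable_within_continuous => x /acute h; exact: derivable_kernel.
  congr fine; apply: eq_integral => x; rewrite inE /= => /acute h.
  rewrite /gamma_integrand /F fctE /= dF1//; congr EFin.
  have m0 := nlncos_gt0 h; have z0 := cos_gt0_acute h.
  rewrite powRM ?ltW//.
  have -> : expR (- (k%:R * nlncos x)) = cos x ^+ k.
    by rewrite /nlncos mulrN opprK expRM_natl lnK ?posrE.
  by ring.
- move=> x y /acute /andP[x0 _] /acute /andP[_ y1] xy.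
  by rewrite /F ltr_pM2l// nlncos_homo.
- by move=> x xcd; apply: cF1; apply: acute; apply: subset_itv_oo_cc xcd.
- apply/cvg_ex; eexists; apply: cvg_at_right_filter; apply: cF1; exact: acute hc.
- apply/cvg_ex; eexists; apply: cvg_at_left_filter; apply: cF1; exact: acute hd.
- split.
  + move=> x xcd; have : x \in `[c, d] by apply: subset_itv_oo_cc xcd.
    by move=> /acute /dF [].
  + by apply: cvg_at_right_filter; exact: contF hc.
  + by apply: cvg_at_left_filter; exact: contF hd.
- apply: derivable_within_continuous => u; rewrite in_itv/= => /andP[u0 _].
  have up : 0 < u.
    by apply: lt_le_trans u0; rewrite /F mulr_gt0// nlncos_gt0//; exact: acute hc.
  have h := is_derive1_powR p up.
  have h1 : is_derive u 1 (fun u => expR (- u)) (expR (- u) * -1).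
    exact: (@is_derive1_comp _ (@expR R) (@GRing.opp R)).
  have e1 : derivable (fun u => u `^ p) u 1 by case: h.
  have e2 : derivable (fun u => expR (- u)) u 1 by case: h1.
  exact: (@derivableM _ _ _ _ u 1 e1 e2).
Qed.

End GammaNoise.

(** * From angles to fractional powers *)

Section GammaLimit.
Variable R : realType.
Local Notation mu := (@lebesgue_measure R).
Implicit Types (p s : R).

Lemma measurable_gamma_integrand p : measurable_fun [set: R] (gamma_integrand p).
Proof.
apply: measurable_funM; first exact: measurable_powR.
by apply: measurableT_comp => //; exact: measurable_funN.
Qed.

Lemma gamma_integrand_ge0 p u : 0 <= gamma_integrand p u :> R.
Proof. by rewrite mulr_ge0 ?powR_ge0 ?expR_ge0. Qed.

Definition trunc_lo m : R := m.+1%:R^-1.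
Definition trunc_hi m : R := m.+1%:R.

(** A nonzero [Gamma p] is the value of a finite integral, because an infinite
    one is read as 0; the same remark serves in [trunc_le_kernel]. *)
Lemma gamma_trunc_cvg p (k : nat) : (0 < k)%N -> Gamma p != 0 ->
  ((\int[mu]_(u in `[k%:R * trunc_lo m, k%:R * trunc_hi m])
       gamma_integrand (p - 1) u)%R
    @[m --> \oo] --> Gamma p)%classic.
Proof.
move=> k0 G0; have k1 : 0 < k%:R :> R by rewrite ltr0n.
pose I m : set R := `[k%:R * trunc_lo m, k%:R * trunc_hi m]%classic.
have UI : (\bigcup_m I m = `]0, +oo[)%classic.
  apply/seteqP; split => [u [m _]|u]; rewrite /I /= !in_itv/=.
    move=> /andP[h _]; rewrite andbT; apply: lt_le_trans h.
    by rewrite mulr_gt0// invr_gt0 ltr0n.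
  rewrite andbT => u0.
  pose m := maxn (Num.truncn (k%:R / u)) (Num.truncn (u / k%:R)).
  have h1 : k%:R / u <= m.+1%:R.
    by apply/ltW/(lt_le_trans (truncnS_gt _)); rewrite ler_nat ltnS leq_maxl.
  have h2 : u / k%:R <= m.+1%:R.
    by apply/ltW/(lt_le_trans (truncnS_gt _)); rewrite ler_nat ltnS leq_maxr.
  exists m => //=; rewrite in_itv/= /trunc_lo /trunc_hi.
  rewrite ler_pdivrMr ?ltr0n// [u * _]mulrC -ler_pdivrMr// h1/=.
  by rewrite [k%:R * _]mulrC -ler_pdivrMr.
have H : ((\int[mu]_(u in I m) (gamma_integrand (p - 1) u)%:E)%E @[m --> \oo] -->
   (\int[mu]_(u in `]0%R, +oo[) (gamma_integrand (p - 1) u)%:E)%E)%classic.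
  rewrite -UI; apply: ge0_nondecreasing_set_cvg_integral.
  - move=> m m' mm; apply/subsetPset => u; rewrite /I /= !in_itv/= => /andP[h1 h2].
    apply/andP; split.
      apply: le_trans h1; rewrite ler_pM2l// lef_pV2 ?posrE ?ltr0n//.
      by rewrite ler_nat ltnS.
    by apply: (le_trans h2); rewrite ler_pM2l// ler_nat ltnS.
  - by move=> m; exact: measurable_itv.
  - move=> m; apply/measurable_EFinP; apply: measurable_funS (measurable_gamma_integrand _) => //.
  - by move=> m u _; rewrite lee_fin gamma_integrand_ge0.
have GE : Gamma p = fine (\int[mu]_(u in `]0%R, +oo[) (gamma_integrand (p - 1) u)%:E)%E by [].
apply: fine_cvg; rewrite GE fineK//.
rewrite ge0_fin_numE; last by apply: integral_ge0 => u _; rewrite lee_fin gamma_integrand_ge0.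
by move: G0; rewrite GE; case: (integral _ _ _) => //=; rewrite ?eqxx// => r _; rewrite ltry.
Qed.

Lemma measurable_nlncos_powR p : measurable_fun [set: R] (fun x => nlncos x `^ p).
Proof.
apply: (measurableT_comp (measurable_powR p)).
apply: measurable_funN; apply: (measurableT_comp (@measurable_ln R)).
by apply: continuous_measurable_fun; exact: continuous_cos.
Qed.

Lemma continuous_nlncos_powR p a b : 0 < a -> b < pi / 2 ->
  ({within `[a, b], continuous (fun x : R => nlncos x `^ p)})%classic.
Proof.
move=> a0 b1; apply: derivable_within_continuous => x.
rewrite in_itv/= => /andP[h1 h2].
have h : 0 < x < pi / 2 by apply/andP; split; lra.
by case: (is_derive_nlncos_powR h p).
Qed.

Lemma trunc_le_kernel p a b : 0 < a -> b < pi / 2 ->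
  (\int[mu]_(x in `[0%R, (pi / 2)%R]) (nlncos x `^ p) != 0)%R ->
  (\int[mu]_(x in `[a, b]) (nlncos x `^ p) <=
   \int[mu]_(x in `[0%R, (pi / 2)%R]) (nlncos x `^ p))%R.
Proof.
move=> a0 b1; rewrite /Rintegral => K0.
have h : (\int[mu]_(x in `[a, b]) (nlncos x `^ p)%:E <=
   \int[mu]_(x in `[0%R, (pi / 2)%R]) (nlncos x `^ p)%:E)%E.
  apply: ge0_subset_integral => //.
  - by apply/measurable_EFinP; apply: measurable_funS (measurable_nlncos_powR p).
  - by move=> x _; rewrite lee_fin powR_ge0.
  - by move=> x /=; rewrite !in_itv/= => /andP[h1 h2]; apply/andP; split; lra.
apply: fine_le => //; rewrite ge0_fin_numE ?integral_ge0//; last 3 first.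
- by move=> x _; rewrite lee_fin powR_ge0.
- by move: K0 => {h}; case: (integral _ _ _) => //=; rewrite ?eqxx// => r _; rewrite ltry.
- by move=> x _; rewrite lee_fin powR_ge0.
apply: le_lt_trans h _.
by move: K0; case: (integral _ _ _) => //=; rewrite ?eqxx// => r _; rewrite ltry.
Qed.

(** The left-hand side times Gamma (1 - alpha) is the integral of
    (- ln cos x)^(-alpha) tan x times the sum in the hypothesis at
    rho = cos x.  The bound by cot x of that sum cancels the tangent and leaves
    the integral that defines [Kconst]. *)
Lemma power_sum_le_Kconst (I : eqType) (r : seq I) (k : I -> nat) (c : I -> R)
    (S alpha : R) :
  0 <= S -> (forall i, i \in r -> (0 < k i)%N) ->
  (forall rho, 0 < rho -> rho < 1 ->
    \sum_(i <- r) (k i)%:R * rho ^+ k i * c i <= rho / Num.sqrt (1 - rho ^+ 2) * S) ->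
  Kconst alpha != 0 ->
  \sum_(i <- r) (k i)%:R `^ alpha * c i <= Kconst alpha * S.
Proof.
move=> S0 k0 H; rewrite /Kconst.
set G := Gamma _; set K := (\int[mu]_(x in _) _)%R => GK.
(* A nonzero constant makes both integrals in it finite and nonzero. *)
have G0 : G != 0 by apply: contraNneq GK => ->; rewrite invr0 mul0r.
have K0 : K != 0 by apply: contraNneq GK => ->; rewrite mulr0.
have Gpos : 0 < G.
  by rewrite lt_def G0 /G /Gamma; apply: Rintegral_ge0 => u _; exact: gamma_integrand_ge0.
rewrite -mulrA [G^-1 * _]mulrC ler_pdivlMr// mulr_suml.
pose J m := (\sum_(i <- r) (k i)%:R `^ alpha * c i *
  (\int[mu]_(u in `[(k i)%:R * trunc_lo m, (k i)%:R * trunc_hi m])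
     gamma_integrand (1 - alpha - 1) u)%R).
have cvgJ : (J m @[m --> \oo] --> \sum_(i <- r) (k i)%:R `^ alpha * c i * G)%classic.
  rewrite /J; elim: r k0 {H J} => [|i r IH] k0.
    under eq_cvg do rewrite big_nil.
    by rewrite big_nil; exact: cvg_cst.
  under eq_cvg do rewrite big_cons.
  rewrite big_cons; apply: cvgD.
    apply: cvgM; first exact: cvg_cst.
    by apply: gamma_trunc_cvg => //; apply: k0; rewrite mem_head.
  by apply: IH => j jr; apply: k0; rewrite in_cons jr orbT.
apply: (cvgr_to_le cvgJ); apply: nearW => m.
have lo0 : 0 < trunc_lo m by rewrite invr_gt0 ltr0n.
have hi0 : 0 < trunc_hi m by rewrite ltr0n.
have lohi : trunc_lo m <= trunc_hi m.
  by apply: (@le_trans _ _ 1); [rewrite invf_le1 ?ltr0n// ler1n|rewrite ler1n].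
set a := acos (expR (- trunc_lo m)); set b := acos (expR (- trunc_hi m)).
have /andP[a0 a1] : 0 < a < pi / 2 by exact: acos_expR_acute.
have /andP[b0 b1] : 0 < b < pi / 2 by exact: acos_expR_acute.
pose Q i x := nlncos x `^ (- alpha) * ((k i)%:R * cos x ^+ k i * (sin x / cos x)).
have acute x : x \in `[a, b] -> 0 < x < pi / 2.
  by rewrite in_itv/= => /andP[h1 h2]; apply/andP; split; lra.
have intQ i : mu.-integrable `[a, b]%classic (EFin \o Q i).
  apply: continuous_compact_integrable; first exact: segment_compact.
  by apply: derivable_within_continuous => x /acute h; exact: derivable_kernel.
have intcQ i : mu.-integrable `[a, b]%classic (EFin \o (fun x => c i * Q i x)).
  exact: (integrableZl _ (c i) (intQ i)).
have intS r' : mu.-integrable `[a, b]%classic (EFin \o (fun x => \sum_(i <- r') c i * Q i x)).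
  elim: r' => [|i r' IH].
    have -> : (fun x => \sum_(i <- [::]) c i * Q i x) = fun=> 0.
      by apply/funext => x; rewrite big_nil.
    exact: integrable0.
  have -> : (fun x => \sum_(i0 <- i :: r') c i0 * Q i0 x) =
      fun x => c i * Q i x + \sum_(i0 <- r') c i0 * Q i0 x.
    by apply/funext => x; rewrite big_cons.
  exact: (integrableD _ (intcQ i) IH).
have intK : mu.-integrable `[a, b]%classic (EFin \o (fun x => nlncos x `^ (- alpha))).
  apply: continuous_compact_integrable; first exact: segment_compact.
  exact: continuous_nlncos_powR.
have JE : J m = (\int[mu]_(x in `[a, b]) (\sum_(i <- r) c i * Q i x))%R.
  transitivity (\sum_(i <- r) (\int[mu]_(x in `[a, b]) (c i * Q i x))%R).
    rewrite /J !big_seq; apply: eq_bigr => i ir.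
    have ki : 0 < (k i)%:R :> R by rewrite ltr0n k0.
    rewrite gamma_subst ?k0// RintegralZl//.
    have -> : 1 - alpha - 1 = - alpha by ring.
    by rewrite powRN mulrACA mulfV ?mul1r// gt_eqF// powR_gt0.
  elim: {H J cvgJ k0} r => [|i r IH].
    rewrite big_nil; under eq_Rintegral do rewrite big_nil.
    by rewrite /Rintegral integral0.
  rewrite big_cons IH -RintegralD//.
  by apply: eq_Rintegral => x _; rewrite big_cons.
rewrite JE.
apply: (@le_trans _ _ (\int[mu]_(x in `[a, b]) (S * nlncos x `^ (- alpha)))%R).
  apply: le_Rintegral => //.
  - exact: (integrableZl _ S intK).
  - move=> x /acute h.
    have z0 := cos_gt0_acute h; have z1 := cos_lt1_acute h; have s0 := sin_gt0_acute h.
    have := H (cos x) z0 z1.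
    have -> : Num.sqrt (1 - cos x ^+ 2) = sin x.
      by rewrite -sin2cos2 sqrtr_sqr gtr0_norm.
    move=> {}H.
    have -> : \sum_(i <- r) c i * Q i x = nlncos x `^ (- alpha) * (sin x / cos x) *
        (\sum_(i <- r) (k i)%:R * cos x ^+ k i * c i).
      by rewrite mulr_sumr; apply: eq_bigr => i _; rewrite /Q; ring.
    have -> : S * nlncos x `^ (- alpha) = nlncos x `^ (- alpha) * (sin x / cos x) *
        (cos x / sin x * S) by field; lra.
    apply: ler_wpM2l H.
    by rewrite mulr_ge0 ?powR_ge0// divr_ge0 ?ltW.
rewrite RintegralZl//.
by rewrite [K * S]mulrC; apply: ler_wpM2l => //; exact: trunc_le_kernel.
Qed.
End GammaLimit.

(** * Exponential moments and tails *)

Section Final.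
Variable R : realType.
Local Notation mu := (@lebesgue_measure R).

Lemma Gamma1 : Gamma (1 : R) = 1.
Proof.
rewrite /Gamma.
under eq_Rintegral do rewrite subrr powRr0 mul1r.
have e (x : R) : is_derive x 1 (fun x : R => - expR (- x)) (expR (- x)).
  have h : is_derive x 1 (fun x : R => expR (- x)) (expR (- x) * -1).
    exact: (@is_derive1_comp _ (@expR R) (@GRing.opp R)).
  apply: is_derive_eq; rewrite /=; ring.
have c : continuous (fun x : R => expR (- x)).
  move=> x; apply: (@continuous_comp _ _ _ (@GRing.opp R) (@expR R)).
    exact: opp_continuous.
  exact: continuous_expR.
have I : (\int[mu]_(x in `[0%R, +oo[) (expR (- x))%:E = 1)%E.
  rewrite (@ge0_continuous_FTC2y _ _ (fun x : R => - expR (- x)) 0 0).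
  - by rewrite oppr0 expR0 -EFinB sub0r opprK.
  - by move=> x _; exact: expR_ge0.
  - exact: continuous_subspaceT.
  - rewrite -oppr0; apply: cvgN.
    exact: cvgr_expR.
  - by move=> x _; case: (e x).
  - apply: cvg_at_right_filter; apply: cvgN; exact: c.
  - by move=> x _; rewrite derive1E; have h := e x; rewrite derive_val.
rewrite /Rintegral integral_itv_obnd_cbnd ?I//.
apply/measurable_EFinP; apply: measurable_funTS; exact: continuous_measurable_fun.
Qed.

Lemma Kconst0 : Kconst (0 : R) = pi / 2.
Proof.
rewrite /Kconst subr0 Gamma1 invr1 mul1r oppr0.
under eq_Rintegral do rewrite powRr0.
rewrite Rintegral_cst//= lebesgue_measure_itv /= lte_fin.
have p0 : 0 < pi / 2 :> R by have := @pi_gt0 R; lra.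
by rewrite p0 /= subr0 mul1r.
Qed.

Lemma Kconst_ge0 (alpha : R) : 0 <= Kconst alpha.
Proof.
rewrite mulr_ge0 ?invr_ge0//; apply: Rintegral_ge0 => x _; rewrite ?powR_ge0//.
exact: gamma_integrand_ge0.
Qed.

Variable n : nat.

(** The entropy of the Gibbs state (w, v) contains lambda B, where
    B = E(Re (conj w * F)), and B is itself bounded by the entropy drop.
    With the free parameter kap = sg * lambda the two occurrences of B cancel,
    and an upper bound of ln Z is left. *)
Lemma mean_cosh_laplacian_pow_le (alpha g lambda : R) (f : cube n -> R[i]) :
  Kconst alpha != 0 -> 0 < lambda ->
  (forall x, \sum_j (hdiff j (fun x => complex.Re (f x)) x ^+ 2 +
                     hdiff j (fun x => complex.Im (f x)) x ^+ 2) <= g) ->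
  mean (fun x => (expR (lambda * cabs (laplacian_pow alpha f x)) +
                  expR (- (lambda * cabs (laplacian_pow alpha f x)))) / 2) <=
  expR (lambda ^+ 2 * ((4%:R `^ alpha * Kconst alpha) ^+ 2 * g) / 2).
Proof.
move=> K0 l0 G; pose r x := cabs (laplacian_pow alpha f x).
have Kp : 0 < Kconst alpha by rewrite lt_def K0 Kconst_ge0.
set sg := 4%:R `^ alpha * Kconst alpha.
have sg0 : 0 < sg by rewrite mulr_gt0// powR_gt0// ltr0n.
set f1 := fun x => complex.Re (f x) in G *; set f2 := fun x => complex.Im (f x) in G *.
pose F1 := real_laplacian_pow alpha f1; pose F2 := real_laplacian_pow alpha f2.
have rE x : r x = nrm2 (F1 x) (F2 x).
  by rewrite /r cabsE (laplacian_powE _ _ _).1 (laplacian_powE _ _ _).2.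
pose v x := (expR (lambda * r x) + expR (- (lambda * r x))) / 2.
(* s / r extends sinh (lambda r) / r; at r = 0 the vector F vanishes, so the
   value of the quotient there does not matter. *)
pose s x := (expR (lambda * r x) - expR (- (lambda * r x))) / 2.
pose w1 x := s x / r x * F1 x; pose w2 x := s x / r x * F2 x.
rewrite -[mean _]/(mean v).
have r0 x : 0 <= r x by rewrite rE nrm2_ge0.
have ep x : 0 < expR (lambda * r x) by exact: expR_gt0.
have em x : 0 < expR (- (lambda * r x)) by exact: expR_gt0.
have s0 x : 0 <= s x.
  rewrite divr_ge0// subr_ge0 ler_expR.
  by have := mulr_ge0 (ltW l0) (r0 x); lra.
have nw x : nrm2 (w1 x) (w2 x) = s x.
  have q0 : 0 <= s x / r x by exact: divr_ge0.
  rewrite /w1 /w2 nrm2Z ger0_norm// -rE.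
  have [e|e] := eqVneq (r x) 0; last by field.
  have -> : s x = 0 by rewrite /s e mulr0 oppr0 subrr mul0r.
  by rewrite !mul0r.
have cw : cone w1 w2 v by move=> x; rewrite nw /s /v; have := em x; lra.
have wF x : F1 x * w1 x + F2 x * w2 x = r x * s x.
  have -> : F1 x * w1 x + F2 x * w2 x = s x / r x * (F1 x ^+ 2 + F2 x ^+ 2).
    by rewrite /w1 /w2; ring.
  rewrite -nrm2_sqr -rE.
  have [e|e] := eqVneq (r x) 0; last by field.
  by rewrite e expr0n mulr0 mul0r.
set B := mean (fun x => r x * s x).
set Z := mean v.
have HE : entropy w1 w2 v = lambda * B - ln 2 * Z.
  rewrite /B /Z -!meanZ -meanB; apply: eq_mean => x; rewrite nw /psi /xlnx.
  have -> : (v x + s x) / 2 = expR (lambda * r x) / 2 by rewrite /v /s; field.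
  have -> : (v x - s x) / 2 = expR (- (lambda * r x)) / 2 by rewrite /v /s; field.
  by rewrite !ln_div ?posrE// !expRK /v /s; field.
have Z0 : 0 < Z by apply: mean_gt0; exact: cone_gt0 cw.
have Hd := entropy_ge cw; rewrite -/Z in Hd.
pose kap := sg * lambda.
have kap0 : 0 < kap by rewrite mulr_gt0.
have g0 : 0 <= g.
  by apply: le_trans (G [ffun=> false]); apply: sumr_ge0 => j _; rewrite addr_ge0 ?sqr_ge0.
pose S := (kap * (g * Z) + 2 / kap * (entropy w1 w2 v - Z * ln (Z / 2))) / 2.
have S0 : 0 <= S.
  have k1 : 0 <= 2 / kap by rewrite divr_ge0// ltW.
  rewrite divr_ge0// addr_ge0//; first by do 2?[apply: mulr_ge0 => //]; exact: ltW.
  by rewrite mulr_ge0// subr_ge0.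
pose c A := coef f1 A * coef w1 A + coef f2 A * coef w2 A.
have := @power_sum_le_Kconst R _ [seq A <- index_enum {set 'I_n} | A != finset.set0]
  (fun A => #|A|) c S alpha S0.
have h1 : forall A : {set 'I_n},
    A \in [seq A <- index_enum {set 'I_n} | A != finset.set0] -> (0 < #|A|)%N.
  by move=> A; rewrite mem_filter card_gt0 => /andP[].
move=> /(_ h1); have h2 rho : 0 < rho -> rho < 1 ->
    \sum_(A <- [seq A <- index_enum {set 'I_n} | A != finset.set0])
      #|A|%:R * rho ^+ #|A| * c A <= rho / Num.sqrt (1 - rho ^+ 2) * S.
  move=> rho0 rho1.
  have := energy_noise_le_entropy cw G kap0 rho0 rho1.
  under [X in 2 * X]eq_mean do rewrite big_split.
  rewrite meanD !energy_walsh -big_split /=.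
  rewrite big_filter (bigD1 finset.set0) //= cards0 !mul0r addr0 add0r.
  under eq_bigr do rewrite -mulrDr.
  rewrite -/Z /S; lra.
move=> /(_ h2 K0) {h2} Gm.
have BE : B = 4%:R `^ alpha * \sum_(A <- [seq A <- index_enum {set 'I_n} | A != finset.set0])
    #|A|%:R `^ alpha * c A.
  rewrite /B; under eq_mean do rewrite -wF.
  rewrite meanD !mean_real_laplacian_pow_mul -big_split /= big_filter mulr_sumr.
  apply: eq_bigr => A _.
  by rewrite natrM powRM// /c; ring.
have {Gm} BS : B <= sg * S.
  rewrite BE /sg -mulrA; apply: ler_wpM2l Gm; exact: powR_ge0.
have lnZ : ln (Z / 2) = ln Z - ln 2 by rewrite ln_div ?posrE.
have E1 : sg * S = lambda * (sg ^+ 2 * g) / 2 * Z + B - Z * ln Z / lambda.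
  by rewrite /S HE lnZ /kap; field; lra.
have E2 : Z * ln Z / lambda <= lambda * (sg ^+ 2 * g) / 2 * Z by lra.
have E3 : ln Z <= lambda ^+ 2 * (sg ^+ 2 * g) / 2.
  rewrite ler_pdivrMr// in E2.
  rewrite -(ler_pM2l Z0); apply: le_trans E2 _.
  by rewrite le_eqVlt; apply/orP; left; apply/eqP; field.
by rewrite -[Z]lnK ?posrE// ler_expR.
Qed.

Lemma Pr_le1 (A : {set cube n}) : Pr R A <= 1.
Proof.
rewrite /Pr ler_pdivrMr ?exprn_gt0// mul1r -natrX ler_nat.
by apply: leq_trans (max_card _) _; rewrite card_ffun card_bool card_ord.
Qed.

Lemma markov_Pr (h : cube n -> R) (A : {set cube n}) (a : R) :
  (forall x, 0 <= h x) -> (forall x, x \in A -> a <= h x) ->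
  Pr R A * a <= mean h.
Proof.
move=> h0 hA; rewrite /Pr /mean mulrAC ler_pM2r ?invr_gt0 ?exprn_gt0//.
rewrite -sum1_card natr_sum mulr_suml.
rewrite [leRHS](bigID (mem A))/= -[leLHS]addr0 lerD ?sumr_ge0//.
by apply: ler_sum => x xA; rewrite mul1r hA.
Qed.

Lemma gradnorm_sqr (f : cube n -> R[i]) x : gradnorm f x ^+ 2 =
  4 * \sum_j (hdiff j (fun x => complex.Re (f x)) x ^+ 2 +
                     hdiff j (fun x => complex.Im (f x)) x ^+ 2).
Proof.
rewrite /gradnorm sqr_sqrtr; last by apply: sumr_ge0 => j _; exact: sqr_ge0.
rewrite mulr_sumr; apply: eq_bigr => j _.
by rewrite cabsE nrm2_sqr /partial -/(flip x j) ReB ImB /hdiff; field.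
Qed.

Lemma gradnorm_ge0 (f : cube n -> R[i]) x : 0 <= gradnorm f x.
Proof. exact: sqrtr_ge0. Qed.

Lemma gradnorm_le (f : cube n -> R[i]) x : gradnorm f x <= supnorm (gradnorm f).
Proof.
rewrite /supnorm; apply: le_trans (ler_norm _) _.
exact: (@le_bigmax _ _ _ 0 (fun x => `|gradnorm f x|) x).
Qed.

(** When [Kconst alpha] is 0, which happens if one of its integrals diverges, the
    right-hand side is 2. *)
Lemma tail_laplacian_pow (alpha t : R) (f : cube n -> R[i]) : 0 < t ->
  Pr R [set x : cube n | t < cabs (laplacian_pow alpha f x)]%SET <=
  if supnorm (gradnorm f) == 0 then 0 else
  2 * expR (- (2 * t ^+ 2 /
    ((4%:R `^ alpha * Kconst alpha) ^+ 2 * supnorm (gradnorm f) ^+ 2))).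
Proof.
move=> t0; set G := supnorm _; case: ifPn => G0.
  rewrite (_ : [set x | _]%SET = finset.set0) ?/Pr ?cards0 ?mul0r//.
  apply/setP => x; rewrite !inE.
  rewrite laplacian_pow_const ?cabsE /= ?/nrm2 ?expr0n ?addr0 ?sqrtr0 ?ltNge ?ltW// => j y.
  have g0 : gradnorm f y = 0.
    by apply/eqP; rewrite eq_le gradnorm_ge0 andbT -(eqP G0) gradnorm_le.
  move/eqP: g0; rewrite sqrtr_eq0 => h.
  have /eqP : \sum_(j < n) cabs (partial j f y) ^+ 2 = 0.
    by apply/eqP; rewrite eq_le h sumr_ge0// => i _; exact: sqr_ge0.
  rewrite psumr_eq0; last by move=> i _; exact: sqr_ge0.
  move=> /allP /(_ j (mem_index_enum _)); rewrite sqrf_eq0 => /eqP.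
  exact: ComplexField.Normc.eq0_normc.
have Gp : 0 < G.
  by rewrite lt_def G0 (le_trans (gradnorm_ge0 f [ffun=> false]) (gradnorm_le _ _)).
have [K0|K0] := eqVneq (Kconst alpha) 0.
  rewrite K0 mulr0 expr0n mul0r invr0 mulr0 oppr0 expR0 mulr1.
  by apply: le_trans (Pr_le1 _) _; rewrite ler1n.
have Kp : 0 < Kconst alpha by rewrite lt_def K0 Kconst_ge0.
set sg := 4%:R `^ alpha * Kconst alpha.
have sg0 : 0 < sg by rewrite mulr_gt0// powR_gt0// ltr0n.
pose s2 := sg ^+ 2 * (G ^+ 2 / 4).
have s20 : 0 < s2 by rewrite mulr_gt0 ?divr_gt0 ?exprn_gt0.
(* The minimizer of la^2 s2 / 2 - la t. *)
pose la := t / s2.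
have la0 : 0 < la by rewrite divr_gt0.
have grad x : \sum_j (hdiff j (fun x => complex.Re (f x)) x ^+ 2 +
                     hdiff j (fun x => complex.Im (f x)) x ^+ 2) <= G ^+ 2 / 4.
  rewrite ler_pdivlMr// mulrC -gradnorm_sqr.
  by rewrite ler_pXn2r ?nnegrE ?gradnorm_ge0 ?gradnorm_le// ltW.
have := mean_cosh_laplacian_pow_le K0 la0 grad; rewrite -/sg -/s2 /=.
set h := fun x => (expR _ + _) / 2; set P := Pr _ _ => M.
have {}M : P * (expR (la * t) / 2) <= expR (la ^+ 2 * s2 / 2).
  apply: le_trans M; apply: markov_Pr => x.
    by rewrite divr_ge0// addr_ge0// expR_ge0.
  rewrite inE => tx; rewrite ler_pM2r//.
  apply: (@le_trans _ _ (expR (la * cabs (laplacian_pow alpha f x)))).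
    by rewrite ler_expR ler_pM2l// ltW.
  by rewrite lerDl expR_ge0.
rewrite mulrA ler_pdivrMr// -ler_pdivlMr ?expR_gt0// in M.
apply: le_trans M _; rewrite mulrAC mulrC -expRN -expRD ler_pM2l//.
rewrite ler_expR le_eqVlt; apply/orP; left; apply/eqP.
by rewrite /la /s2; field; lra.
Qed.

End Final.

Theorem corollary4p2 (R : realType) (n : nat) (hn : (1 <= n)%N)
    (f : cube n -> R[i]) (t : R) (ht : 0 < t) :
  Pr R [set x : cube n | t < cabs (f x - Ex f)]%SET <=
    (if supnorm (gradnorm f) == 0 then 0 else
       2 * expR (- (8 * t ^+ 2 / (pi ^+ 2 * supnorm (gradnorm f) ^+ 2))))
  /\
  forall alpha : R, 0 < alpha -> alpha < 1 / 2 ->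
  Pr R [set x : cube n | t < cabs (laplacian_pow alpha f x)]%SET <=
    (if supnorm (gradnorm f) == 0 then 0 else
       2 * expR (- (t ^+ 2 /
         (2 * Kconst alpha ^+ 2 * supnorm (gradnorm f) ^+ 2)))).
Proof.
split.
  have := tail_laplacian_pow 0 f ht.
  under eq_finset do rewrite laplacian_pow0.
  rewrite powRr0 mul1r Kconst0.
  case: ifPn => // G0.
  suff -> : 2 * t ^+ 2 / ((pi / 2) ^+ 2 * supnorm (gradnorm f) ^+ 2) =
    8 * t ^+ 2 / (pi ^+ 2 * supnorm (gradnorm f) ^+ 2) by [].
  have := @pi_gt0 R; move: (@pi R) => p p0.
  by field; rewrite G0 gt_eqF.
move=> alpha a0 a1; apply: le_trans (tail_laplacian_pow alpha f ht) _.
case: ifPn => // G0.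
rewrite ler_pM2l// ler_expR lerN2.
have [K0|K0] := eqVneq (Kconst alpha) 0.
  by rewrite K0 !(mulr0, expr0n, mul0r, invr0).
set K := Kconst alpha in K0 *; set G := supnorm _ in G0 *.
have q0 : 0 < 4%:R `^ alpha :> R by rewrite powR_gt0// ltr0n.
(* This is where alpha < 1/2 enters. *)
have q2 : 4%:R `^ alpha <= 2 :> R.
  have -> : 2 = 4%:R `^ (2^-1) :> R.
    by rewrite powR12_sqrt// (_ : 4%:R = 2 ^+ 2) ?sqrtr_sqr ?gtr0_norm// -natrX.
  by apply: ler_powR; [rewrite ler1n|lra].
set q := 4%:R `^ alpha in q0 q2 *.
have kg : 0 < K ^+ 2 * G ^+ 2 by rewrite mulr_gt0// lt_def sqr_ge0 expf_neq0.
have -> : t ^+ 2 / (2 * K ^+ 2 * G ^+ 2) = t ^+ 2 / (K ^+ 2 * G ^+ 2) / 2.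
  by field; rewrite K0 G0.
have -> : 2 * t ^+ 2 / ((q * K) ^+ 2 * G ^+ 2) = t ^+ 2 / (K ^+ 2 * G ^+ 2) * (2 / q ^+ 2).
  by field; rewrite K0 G0 gt_eqF.
apply: ler_wpM2l; first by rewrite divr_ge0 ?sqr_ge0 ?ltW.
rewrite -[leLHS]mul1r ler_pdivlMr ?exprn_gt0//.
by rewrite expr2; nra.
Qed.
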